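(* Let $I$ be a proper nonzero monomial ideal of $S=\mathbb{K}[x_1,\ldots,x_n]$. Then $$\operatorname{reg}(I)\geq \operatorname{reg}(\sqrt{I})+(\gamma(I)-1)h,$$ where $h$ denotes the height of $I$.
   Context: $\mathbb{K}$ is a field and $S=\mathbb{K}[x_1,\ldots,x_n]$ is the (standard graded) polynomial ring in $n$ variables. For a graded $S$-module $M$ with graded Betti numbers $\beta_{i,j}(M)$ (so the minimal graded free resolution of $M$ has $i$-th term $\bigoplus_j S(-j)^{\beta_{i,j}(M)}$), the Castelnuovo--Mumford regularity is $\operatorname{reg}(M)=\max\{j-i : \beta_{i,j}(M)\neq 0\}$; ideals are regarded as graded $S$-modules. For a monomial ideal $I$, $G(I)$ is its unique set of minimal monomial generators. For a monomial $u$, $\deg_{x_j}(u)$ is the exponent of $x_j$ in $u$. Define $$\gamma(I):=\min\{\deg_{x_j}(u) : 1\leq j\leq n,\ u\in G(I),\ x_j \text{ divides } u\}.$$ *)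

(* Defs.v *)
From HB Require Import structures.
From mathcomp Require Import all_boot all_order all_algebra.
From mathcomp Require Import boolp.
From mathcomp Require Import mpoly.

Set Implicit Arguments.
Unset Strict Implicit.
Unset Printing Implicit Defensive.

Import Order.TTheory GRing.Theory Num.Theory.
Local Open Scope ring_scope.

(* Numerical invariants defined as a minimum or maximum are rendered as       *)
(* relations "k is the least / greatest element of A".                        *)
Definition is_least (A : nat -> Prop) (k : nat) : Prop :=
  A k /\ forall l, A l -> (k <= l)%N.

Definition is_greatest (A : nat -> Prop) (k : nat) : Prop :=
  A k /\ forall l, A l -> (l <= k)%N.

Definition is_greatestz (A : int -> Prop) (k : int) : Prop :=
  A k /\ forall l, A l -> l <= k.

Section Ideals.
Variables (K : fieldType) (n : nat).
Local Notation S := {mpoly K[n]}.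

(* p belongs to the ideal generated by the monomials 'X_[u] with u in A.      *)
Definition in_monomial_span (A : 'X_{1..n} -> Prop) (p : S) : Prop :=
  exists s : seq (S * 'X_{1..n}),
    (forall x, x \in s -> A x.2) /\ p = \sum_(x <- s) x.1 * 'X_[x.2].

Definition monomials_generate (A : 'X_{1..n} -> Prop) (I : {pred S}) : Prop :=
  forall p, p \in I <-> in_monomial_span A p.

Definition monomial_ideal (I : {pred S}) : Prop :=
  exists A, monomials_generate A I.

(* G is an inclusion-minimal set of monomial generators of I; for a monomial  *)
(* ideal there is exactly one such G, namely G(I).                            *)
Definition minimal_monomial_generators
    (I : {pred S}) (G : 'X_{1..n} -> Prop) : Prop :=
  monomials_generate G I /\
  forall A : 'X_{1..n} -> Prop,
    (forall u, A u -> G u) -> monomials_generate A I -> forall u, G u -> A u.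

Definition is_gamma (I : {pred S}) (g : nat) : Prop :=
  exists2 G, minimal_monomial_generators I G &
    is_least (fun d => exists u (j : 'I_n),
                [/\ G u, (0 < u j)%N & d = u j]) g.

Definition radical (I : {pred S}) : {pred S} :=
  fun p => `[< exists k, p ^+ k \in I >].

(* idealr_closed includes properness. *)
Definition prime_ideal (P : {pred S}) : Prop :=
  idealr_closed P /\ prime_idealr_closed P.

(* There is a chain of primes P_0 < P_1 < ... < P_k = P. *)
Definition prime_chain (P : {pred S}) (k : nat) : Prop :=
  exists C : nat -> {pred S},
    [/\ forall i, (i <= k)%N -> prime_ideal (C i),
        forall i, (i < k)%N ->
          {subset C i <= C i.+1} /\ ~ {subset C i.+1 <= C i}
      & C k =i P].

Definition prime_height (P : {pred S}) : nat -> Prop :=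
  is_greatest (prime_chain P).

Definition is_height (I : {pred S}) : nat -> Prop :=
  is_least (fun k => exists P : {pred S},
    [/\ prime_ideal P, {subset I <= P} & prime_height P k]).

End Ideals.

Section Resolutions.
Variables (K : fieldType) (n : nat).
Local Notation S := {mpoly K[n]}.

(* p is homogeneous of degree d (so p = 0 when d < 0). *)
Definition homogz (d : int) (p : S) : Prop :=
  forall m, m \in msupp p -> (mdeg m)%:Z = d.

(* A sequence ... -> F_1 -> F_0 -> S of graded maps, where F_i is the direct  *)
(* sum of the S(- fshift i k), k < frank i, and S sits in degree 0.  Elements *)
(* of F_i are row vectors and matrices act on the right: row k of fdiff i is  *)
(* the image in F_i of the k-th basis vector of F_i.+1, which has degree      *)
(* fshift i.+1 k.                                                             *)
Record free_complex := FreeComplex {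
  frank : nat -> nat;
  fshift : forall i, 'I_(frank i) -> int;
  faug : 'cV[S]_(frank 0);
  fdiff : forall i, 'M[S]_(frank i.+1, frank i)
}.

Definition graded_complex (F : free_complex) : Prop :=
  (forall k, homogz (fshift (i := 0%N) k) (faug F k 0)) /\
  (forall i k l,
     homogz (fshift (i := i.+1) k - fshift (i := i) l) (fdiff F i k l)).

(* ... -> F_1 -> F_0 -> I -> 0 is exact. *)
Definition resolves (F : free_complex) (I : {pred S}) : Prop :=
  [/\ forall p, p \in I <-> exists v : 'rV[S]_(frank F 0), p%:M = v *m faug F,
      forall v : 'rV[S]_(frank F 0),
        v *m faug F = 0 <-> exists w, v = w *m fdiff F 0
    & forall i (v : 'rV[S]_(frank F i.+1)),
        v *m fdiff F i = 0 <-> exists w, v = w *m fdiff F i.+1].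

(* The differentials have entries in the graded maximal ideal (x_1,...,x_n).  *)
Definition minimal_complex (F : free_complex) : Prop :=
  forall i k l, (fdiff F i k l)@_0%MM = 0.

Definition minimal_graded_free_resolution
    (F : free_complex) (I : {pred S}) : Prop :=
  [/\ graded_complex F, resolves F I & minimal_complex F].

Definition betti (F : free_complex) (i : nat) (j : int) : nat :=
  #|[pred k : 'I_(frank F i) | fshift k == j]|.

(* reg(I) = r.  Minimal graded free resolutions are unique up to isomorphism, *)
(* so r does not depend on F.                                                 *)
Definition is_regularity (I : {pred S}) (r : int) : Prop :=
  exists2 F, minimal_graded_free_resolution F I &
    is_greatestz (fun d => exists (i : nat) (j : int),
                    betti F i j != 0%N /\ d = j - i%:Z) r.

End Resolutions.

(* Main.v *)
(* Betti numbers are read off Koszul homology: beta_{i,a}(I) is the homology of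
   the upper Koszul complex of I in multidegree a. Write s = reg(rad I) and pick,
   among the squarefree a with beta_{i,a}(rad I) != 0 and |a| - i = s, one with
   |a| maximal. Localising at a variable outside the support of a cannot kill the
   class: by the long exact sequence this would produce homology of rad I either
   above the regularity or in a bigger a. Localising at all of them, rad I stays
   proper, so the product of the variables outside a is not in rad I, and the
   variables of a generate a prime containing I; hence h <= |a|. Conversely, the
   radical is obtained by letting exponents go to infinity one variable at a
   time, and a filtration argument shows that beta_{i,a}(rad I) != 0 forces
   beta_{i,a'}(I) != 0 for some a' with the support of a. All nonzero exponents
   of such an a' are at least gamma, so reg(I) >= gamma |a| - i
   = s + (gamma - 1) |a| >= s + (gamma - 1) h. *)
Require Import Defs.
From HB Require Import structures.
From mathcomp Require Import all_boot all_order all_algebra.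
From mathcomp Require Import boolp.
From mathcomp Require Import mpoly.
From mathcomp Require Import ring zify.

Set Implicit Arguments.
Unset Strict Implicit.
Unset Printing Implicit Defensive.

Import Order.TTheory GRing.Theory Num.Theory.
Local Open Scope ring_scope.

(** * Chains on the subsets of a finite set *)

Section Chains.
Variables (R : comNzRingType) (n : nat).
Implicit Types (c b : {ffun {set 'I_n} -> R}) (T : {set 'I_n}).
Implicit Types (X Y Z : pred {set 'I_n}).

Definition sg (t : 'I_n) T : nat := #|[set s in T | (s < t)%N]|.

Lemma sgU s t T : t \notin T -> sg s (t |: T) = ((t < s)%N + sg s T)%N.
Proof.
move=> tT; rewrite /sg; case: (ltnP t s) => ts.
  rewrite (_ : [set _ in _ | _] = t |: [set s0 in T | (s0 < s)%N]).
    by rewrite cardsU1 inE (negbTE tT).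
  by apply/setP=> x; rewrite !inE; case: eqVneq => [->|] //=; rewrite ts.
congr #|pred_of_set _|; apply/setP=> x; rewrite !inE.
by case: eqVneq => [->|] //=; rewrite ltnNge ts andbF.
Qed.

Lemma sgU1 t T : sg t (t |: T) = sg t T.
Proof.
congr #|pred_of_set _|; apply/setP=> x; rewrite !inE.
by case: eqVneq => [->|] //=; rewrite ltnn andbF.
Qed.

(** The reduced simplicial boundary on coefficients: all subsets, the empty one included, are basis
    elements, and membership in a complex is imposed separately by [csupp]. *)
Definition bdry c : {ffun {set 'I_n} -> R} :=
  [ffun T : {set 'I_n} => \sum_(t | t \notin T) (-1) ^+ sg t T * c (t |: T)].

Definition wedge (j : 'I_n) c : {ffun {set 'I_n} -> R} :=
  [ffun T : {set 'I_n} => if j \in T then (-1) ^+ sg j T * c (T :\ j) else 0].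

Lemma bdryE c T : bdry c T = \sum_(t | t \notin T) (-1) ^+ sg t T * c (t |: T).
Proof. by rewrite ffunE. Qed.

Lemma bdryD b c : bdry (b + c) = bdry b + bdry c.
Proof.
apply/ffunP=> T; rewrite !ffunE -big_split /=.
by apply: eq_bigr => t _; rewrite ffunE mulrDr.
Qed.

Lemma bdryN c : bdry (- c) = - bdry c.
Proof.
apply/ffunP=> T; rewrite !ffunE -sumrN.
by apply: eq_bigr => t _; rewrite ffunE mulrN.
Qed.

Lemma bdryB b c : bdry (b - c) = bdry b - bdry c. Proof. by rewrite bdryD bdryN. Qed.

Lemma bdry0 : bdry 0 = 0.
Proof. by have := bdryB 0 0; rewrite !subrr. Qed.

Lemma wedgeN j c : wedge j (- c) = - wedge j c.
Proof. by apply/ffunP=> T; rewrite !ffunE mulrN; case: ifP; rewrite ?oppr0. Qed.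

Lemma wedge0 j : wedge j 0 = 0.
Proof. by apply/ffunP=> T; rewrite !ffunE mulr0; case: ifP. Qed.

Lemma bdryK c : bdry (bdry c) = 0.
Proof.
apply/ffunP=> T; rewrite !ffunE.
pose F t s := (-1) ^+ (sg t T + sg s T + (t < s))%N * c (s |: (t |: T)).
have -> : \sum_(t | t \notin T) (-1) ^+ sg t T * bdry c (t |: T) =
   \sum_(t | t \notin T) \sum_(s | (s \notin T) && (s != t)) F t s.
  apply: eq_bigr => t tT; rewrite ffunE mulr_sumr; apply: eq_big => s.
    by rewrite !inE negb_or andbC.
  by move=> _; rewrite sgU // mulrA -exprD /F; congr (_ ^+ _ * _); lia.
have -> : \sum_(t | t \notin T) \sum_(s | (s \notin T) && (s != t)) F t s =
   \sum_(t | t \notin T) (\sum_(s | (s \notin T) && (s < t)%N) F t s +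
     \sum_(s | (s \notin T) && (t < s)%N) F t s).
  apply: eq_bigr => t _; rewrite (bigID (fun s : 'I_n => s < t)%N) /=.
  by congr (_ + _); apply: eq_bigl => s; rewrite -val_eqE /=;
      case: (s \notin T) => //=; lia.
(* Swapping s and t in the second half turns it into minus the first half: the two exponents of -1
   differ by one. *)
rewrite big_split /= [X in _ + X](exchange_big_dep (fun s => s \notin T)) /=; last first.
  by move=> ? ? _ /andP[].
rewrite -big_split /= big1 // => t tT.
rewrite (_ : (\sum_(i | (i \notin T) && ((t \notin T) && (i < t)%N)) F i t) =
  - \sum_(s | (s \notin T) && (s < t)%N) F t s) ?subrr //.
rewrite -sumrN; apply: eq_big => [s|s /and3P[_ _ st]]; first by rewrite tT.
have ts: (t < s)%N = false by lia.
by rewrite /F st ts setUCA addn0 addn1 exprS mulN1r mulNr (addnC (sg s T)).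
Qed.

(** Exterior multiplication by e_j is a contracting homotopy of the full simplex. *)
Lemma bdry_wedge j c : bdry (wedge j c) = c - wedge j (bdry c).
Proof.
have sq k : (-1) ^+ k * (-1) ^+ k = 1 :> R.
  by rewrite -exprD addnn -mul2n exprM sqrrN expr1n expr1n.
apply/ffunP=> T; rewrite bdryE [RHS]ffunE [X in _ = _ + X]ffunE [X in _ = _ - X]ffunE.
have [jT|jT] := boolP (j \in T); last first.
  rewrite subr0 (bigD1 j) //= ffunE setU11 sgU1 setU1K // mulrA sq mul1r.
  rewrite big1 ?addr0 // => t /andP[_ tj].
  by rewrite ffunE !inE eq_sym (negbTE tj) (negbTE jT) /= mulr0.
pose U := T :\ j.
have jU : j \notin U by rewrite !inE eqxx.
have TE : T = j |: U by rewrite setD1K.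
rewrite bdryE -/U [X in _ = _ - _ * X](bigD1 j) //= -TE.
rewrite (_ : sg j U = sg j T); last by rewrite TE sgU1.
rewrite mulrDr mulrA sq mul1r opprD addrA subrr sub0r mulr_sumr -sumrN.
apply: eq_big => [t|t tT].
  by rewrite /U !inE; case: eqVneq => [->|_] /=; rewrite ?jT ?andbT ?andbF.
have tj : t != j by apply: contra tT => /eqP->.
rewrite ffunE !inE jT orbT !mulrA -mulNr.
have -> : (t |: T) :\ j = t |: U.
  by apply/setP=> x; rewrite !inE; case: (eqVneq x t) => [->|] //=; rewrite tj.
congr (_ * _); rewrite -!exprD sgU // {1}TE sgU //.
move: tj; rewrite -val_eqE /=; case: ltngtP => // _ _.
by rewrite add0n -[RHS]mulN1r -exprS; congr (_ ^+ _); lia.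
by rewrite add0n -[RHS]mulN1r -exprS; congr (_ ^+ _); lia.
Qed.

Definition jfree (j : 'I_n) c := forall T, j \in T -> c T = 0.

Definition del (j : 'I_n) c : {ffun {set 'I_n} -> R} :=
  [ffun T : {set 'I_n} => if j \in T then 0 else c T].

Definition link (j : 'I_n) c : {ffun {set 'I_n} -> R} :=
  [ffun T : {set 'I_n} => if j \in T then 0 else (-1) ^+ sg j T * c (j |: T)].

Lemma jfree_del j c : jfree j (del j c).
Proof. by move=> T jT; rewrite ffunE jT. Qed.

Lemma jfree_link j c : jfree j (link j c).
Proof. by move=> T jT; rewrite ffunE jT. Qed.

Lemma jfree_bdry j c : jfree j c -> jfree j (bdry c).
Proof.
move=> cf T jT; rewrite bdryE big1 // => t _.
by rewrite cf ?mulr0 // !inE jT orbT.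
Qed.

Lemma jfreeD j b c : jfree j b -> jfree j c -> jfree j (b + c).
Proof. by move=> fb fc T jT; rewrite ffunE fb // fc // addr0. Qed.

Lemma del_link j c : c = del j c + wedge j (link j c).
Proof.
apply/ffunP=> T; rewrite !ffunE; case: ifP => jT; last by rewrite addr0.
rewrite !inE eqxx add0r /= setD1K // mulrA -exprD.
rewrite (_ : sg j (T :\ j) = sg j T); last by rewrite -{2}(setD1K jT) sgU1.
by rewrite addnn -mul2n exprM sqrrN expr1n expr1n mul1r.
Qed.

Lemma jfree_inj j b b' c c' : jfree j b -> jfree j c ->
  b + wedge j b' = c + wedge j c' -> b = c.
Proof.
move=> fb fc /ffunP E; apply/ffunP=> T; have := E T; rewrite !ffunE.
by case: ifP => jT; rewrite ?addr0 // fb // fc.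
Qed.

Definition csupp X (i : nat) c := forall T, c T != 0 -> X T /\ #|T| = i.

Lemma csuppD X i b c : csupp X i b -> csupp X i c -> csupp X i (b + c).
Proof.
move=> hb hc T; rewrite ffunE; have [->|/hb //] := eqVneq (b T) 0.
by rewrite add0r; apply: hc.
Qed.

Lemma csuppN X i c : csupp X i c -> csupp X i (- c).
Proof. by move=> hc T; rewrite ffunE oppr_eq0; apply: hc. Qed.

Lemma csupp0 X i : csupp X i 0.
Proof. by move=> T; rewrite ffunE eqxx. Qed.

Lemma csuppW X Y i c : (forall T, X T -> Y T) -> csupp X i c -> csupp Y i c.
Proof. by move=> XY hc T /hc [/XY]. Qed.

Lemma bdry_neq0 c T : bdry c T != 0 -> exists2 t, t \notin T & c (t |: T) != 0.
Proof.
rewrite bdryE => nz; apply: contrapT => H; case/negP: nz; apply/eqP; apply: big1 => t tT.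
have [->|ct] := eqVneq (c (t |: T)) 0; first by rewrite mulr0.
by case: H; exists t.
Qed.

Lemma bdry_size X i c T : csupp X i c -> bdry c T != 0 -> #|T|.+1 = i.
Proof. by move=> hc /bdry_neq0[t tT /hc[_ <-]]; rewrite cardsU1 tT. Qed.

(* Vanishing of the relative homology of (X, Y) in size i, i.e. in simplicial
   degree i - 1. *)
Definition rel_acyclic i X Y := forall c, csupp X i c -> (forall T, bdry c T != 0 ->
    Y T) ->
  exists b b', [/\ csupp X i.+1 b, csupp Y i b' & c = bdry b + b'].

Definition acyclic i X := rel_acyclic i X pred0.

Lemma acyclicP i X : acyclic i X <-> forall c, csupp X i c -> bdry c = 0 ->
  exists2 b, csupp X i.+1 b & bdry b = c.
Proof.
split=> H c hc.
  move=> c0; have [T|b [b' [hb hb' ->]]] := H c hc.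
    by rewrite c0 ffunE eqxx.
  exists b => //; rewrite (_ : b' = 0) ?addr0 //; apply/ffunP=> T; rewrite ffunE.
  by apply/eqP; apply: contraT => /hb' [].
move=> c0; have [|b hb <-] := H c hc.
  by apply/ffunP=> T; rewrite [RHS]ffunE; apply/eqP; apply: contraT => /c0.
by exists b, 0; split; rewrite ?addr0 //; apply: csupp0.
Qed.

(** The boundary lowers size by one, so discarding the coefficients of b outside size i + 1 does not
    change a boundary of pure size i. *)
Lemma bdry_trim X i c b : csupp X i c -> (forall T, b T != 0 -> X T) -> bdry b = c ->
  exists2 b', csupp X i.+1 b' & bdry b' = c.
Proof.
move=> hc hb bE; exists [ffun T : {set 'I_n} => if #|T| == i.+1 then b T else 0].
  by move=> T; rewrite ffunE; case: ifP => [/eqP sT /hb|]; rewrite ?eqxx.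
apply/ffunP=> T; have [Ti|Ti] := eqVneq #|T| i.
  rewrite -bE !bdryE; apply: eq_bigr => t tT.
  by rewrite ffunE cardsU1 tT Ti add1n eqxx.
rewrite (_ : c T = 0); last by apply/eqP; apply: contraNT Ti => /hc[_ ->].
by rewrite bdryE big1 // => t tT; rewrite ffunE cardsU1 tT add1n eqSS (negbTE Ti) mulr0.
Qed.

(** Middle exactness in the long exact sequence of a triple: a relative cycle is first moved into Y,
    where it is still a cycle modulo Z. *)
Lemma rel_acyclic_trans i X Y Z : (forall T, Y T -> X T) -> (forall T, Z T -> Y T) ->
  rel_acyclic i X Y -> rel_acyclic i Y Z -> rel_acyclic i X Z.
Proof.
move=> YX ZY XY YZ c hc cZ.
have [T /cZ /ZY //|b [b' [hb hb' cE]]] := XY c hc.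
have [T|b2 [b'' [hb2 hb'' b'E]]] := YZ b' hb'.
  rewrite (_ : bdry b' = bdry c); first exact: cZ.
  by rewrite cE bdryD bdryK add0r.
exists (b + b2), b''; split=> //; last by rewrite cE b'E bdryD addrA.
by apply: csuppD => //; apply: csuppW hb2.
Qed.

Lemma rel_acyclic_refl i X Y : (forall T, X T -> Y T) -> rel_acyclic i X Y.
Proof.
by move=> XY c hc _; exists 0, c; split;
    [apply: csupp0|apply: csuppW hc|rewrite bdry0 add0r].
Qed.

Lemma eq_rel_acyclic i X X' Y Y' : X =1 X' -> Y =1 Y' -> rel_acyclic i X Y ->
    rel_acyclic i X' Y'.
Proof.
move=> XX' YY' H c hc hd.
have [||b [b' [hb hb' cE]]] := H c.
- by apply: csuppW hc => T; rewrite XX'.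
- by move=> T /hd; rewrite YY'.
exists b, b'; split=> //; first by apply: csuppW hb => T; rewrite XX'.
by apply: csuppW hb' => T; rewrite YY'.
Qed.

(** From the exact sequence H_{i+1}(X, Y) -> H_i(Y) -> H_i(X): a filling of c in X is a relative
    cycle, and the Y-part of its decomposition fills c. *)
Lemma acyclic_sub i X Y : (forall T, Y T -> X T) ->
  rel_acyclic i.+1 X Y -> acyclic i X -> acyclic i Y.
Proof.
move=> YX XY /acyclicP aX; apply/acyclicP => c hc c0.
have [|b hb bE] := aX c _ c0; first by apply: csuppW hc.
have [T|b2 [b' [_ hb' bE']]] := XY b hb; first by rewrite bE => /hc [].
by exists b' => //; rewrite -bE bE' bdryD bdryK add0r.
Qed.

End Chains.

(** * Upper Koszul complexes *)

Section UpperKoszul.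
Variables (R : comNzRingType) (n : nat).
Implicit Types (P : pred 'X_{1..n}) (a u v : 'X_{1..n}) (T : {set 'I_n}).
Implicit Types (c b : {ffun {set 'I_n} -> R}).

Definition upward P := forall u v, (u <= v)%MM -> P u -> P v.

(* The upper Koszul simplicial complex in degree a of the monomial ideal whose
   monomials satisfy P; its homology in size i is Tor_i of that ideal in degree a. *)
Definition Kos P a : pred {set 'I_n} :=
  fun T => (mesym1 T <= a)%MM && P (a - mesym1 T)%MM.

Definition Kos_del P (j : 'I_n) a : pred {set 'I_n} := fun T => (j \notin T) && Kos P a T.

Definition set_exp a (j : 'I_n) m : 'X_{1..n} :=
  [multinom if k == j then m else a k | k < n].

Lemma mesym1_mem T (j : 'I_n) : mesym1 T j = (j \in T). Proof. exact: mnmE. Qed.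

Lemma set_expE a j m k : set_exp a j m k = if k == j then m else a k.
Proof. exact: mnmE. Qed.

Lemma set_exp_set_exp a j m m' : set_exp (set_exp a j m) j m' = set_exp a j m'.
Proof. by apply/mnmP => k; rewrite !set_expE; case: eqP. Qed.

(** Adding j to a face uses up one power of x_j, so the link of j is the deletion of j in degree a -
    U_(j). *)
Lemma KosU P j a T : (0 < a j)%N -> j \notin T ->
    Kos P a (j |: T) = Kos P (a - U_(j))%MM T.
Proof.
move=> aj jT; rewrite /Kos; congr andb.
  apply/mnm_lepP/mnm_lepP => H k; have := H k;
    rewrite !mnmBE !mesym1_mem !inE mnm1E (eq_sym j k);
    by case: eqVneq => [->|_] /=; rewrite ?(negbTE jT) ?subn0.
congr P; apply/mnmP => k; rewrite !mnmBE !mesym1_mem !inE mnm1E (eq_sym j k).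
by case: eqVneq => [->|_] /=; rewrite ?(negbTE jT) ?subn0.
Qed.

Lemma Kos_del_sub P j a (b' : 'X_{1..n}) T : upward P -> (forall k, k != j ->
    a k = b' k) ->
  (a j <= b' j)%N -> Kos_del P j a T -> Kos_del P j b' T.
Proof.
move=> Pu ab abj /and3P[jT Ta PT]; rewrite /Kos_del jT /=; apply/andP; split.
  apply/mnm_lepP => k; have /mnm_lepP/(_ k) := Ta; rewrite mesym1_mem.
  by case: (eqVneq k j) => [->|/ab ->]; rewrite ?(negbTE jT).
apply: Pu PT; apply/mnm_lepP => k; rewrite !mnmBE mesym1_mem.
by case: (eqVneq k j) => [->|/ab ->]; rewrite // (negbTE jT) !subn0.
Qed.


Lemma csupp_wedge P j a i c : (0 < a j)%N ->
  csupp (Kos_del P j (a - U_(j))%MM) i c -> csupp (Kos P a) i.+1 (wedge j c).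
Proof.
move=> aj hc T; rewrite ffunE; case: ifP => [jT nz|_]; last by rewrite eqxx.
have /hc[/andP[jT' KT] <-] : c (T :\ j) != 0.
  by apply: contra nz => /eqP->; rewrite mulr0.
rewrite -{1}(setD1K jT) KosU //; split=> //.
by rewrite -{1}(setD1K jT) cardsU1 jT'.
Qed.

Lemma csupp_del P j a i c : csupp (Kos P a) i c -> csupp (Kos_del P j a) i (del j c).
Proof.
move=> hc T; rewrite ffunE; case: ifP => jT; first by rewrite eqxx.
by move=> /hc[KT sT]; rewrite /Kos_del jT.
Qed.

Lemma csupp_link P j a i c : (0 < a j)%N ->
  csupp (Kos P a) i c -> csupp (Kos_del P j (a - U_(j))%MM) i.-1 (link j c).
Proof.
move=> aj hc T; rewrite ffunE; case: ifP => jT; first by rewrite eqxx.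
move=> nz; have /hc[KT <-] : c (j |: T) != 0 by apply: contra nz => /eqP->; rewrite mulr0.
by rewrite /Kos_del jT -KosU // ?jT // cardsU1 jT.
Qed.

Lemma csupp_jfree P j a i c : csupp (Kos_del P j a) i c -> jfree j c.
Proof.
move=> hc T jT; apply/eqP; apply: contraT => /hc[/andP[]].
by rewrite jT.
Qed.

(* A chain is b + e_j b' with b and b' not involving j; it is a cycle exactly
   when b' = - bdry b, i.e. when b is a cycle relative to the family of b'. *)
Lemma acyclic_rel P j a i : upward P -> (0 < a j)%N ->
  acyclic R i (Kos P a) <-> rel_acyclic R i (Kos_del P j a) (Kos_del P j (a - U_(j))%MM).
Proof.
move=> Pu aj; split.
- move=> /acyclicP H c hc hd.
  have [||B hB BE] := H (c - wedge j (bdry c)).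
  + apply: csuppD; first by apply: csuppW hc => T /andP[].
    (* In size 0 the boundary is zero, so the missing predecessor of i does no harm. *)
    apply: csuppN; case: i hc {H} => [|i] hc.
      rewrite (_ : bdry c = 0) => [|]; last first.
        by apply/ffunP=> T; rewrite [RHS]ffunE; apply/eqP;
            apply: contraT => /(bdry_size hc).
      rewrite (_ : wedge j 0 = 0); first exact: csupp0.
      by apply/ffunP=> T; rewrite !ffunE mulr0; case: ifP.
    apply: csupp_wedge => // T nz; split; first exact: hd.
    by have [] := bdry_size hc nz.
  + by rewrite bdryB bdry_wedge bdryK opprB addrC subrK wedge0.
  exists (del j B), (link j B); split.
  + exact: csupp_del.
  + exact: csupp_link hB.
  + have fc := csupp_jfree hc.
    apply: (@jfree_inj _ _ j _ (- bdry c) _ (- bdry (link j B))) => //.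
      by apply: jfreeD; [apply/jfree_bdry/jfree_del|apply: jfree_link].
    by rewrite !wedgeN -BE {1}(del_link j B) bdryD bdry_wedge addrA.
- move=> H; apply/acyclicP => c hc c0.
  have cE := del_link j c; set d := del j c in cE; set l := link j c in cE.
  have fd : jfree j d by apply: jfree_del.
  have fl : jfree j l by apply: jfree_link.
  (* This is the part of [bdry c = 0] that does not involve j. *)
  have dl : bdry d = - l.
    apply/eqP; rewrite -addr_eq0; apply/eqP.
    apply: (@jfree_inj _ _ j _ (- bdry l) _ 0).
    + by apply: jfreeD => //; apply: jfree_bdry.
    + by move=> T _; rewrite ffunE.
    + by rewrite wedgeN wedge0 addr0 -addrA -bdry_wedge -bdryD -cE.
  have hl := csupp_link aj hc.
  have [||b [b' [hb hb' dE]]] := H d.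
  + exact: csupp_del.
  + by move=> T; rewrite dl ffunE oppr_eq0 => /hl[].
  exists (b + wedge j b').
    apply: csuppD; last exact: csupp_wedge.
    by apply: csuppW hb => T /andP[].
  rewrite cE bdryD bdry_wedge dE (_ : bdry b' = - l) ?wedgeN ?opprK ?addrA //.
  by rewrite -dl dE bdryD bdryK add0r.
Qed.

Lemma set_exp_subU a j : (a - U_(j))%MM = set_exp a j (a j).-1.
Proof.
apply/mnmP => k; rewrite mnmBE mnm1E set_expE (eq_sym j k).
by case: eqVneq => [->|_]; rewrite ?subn0 ?subn1.
Qed.

Lemma set_exp_subT a j m T : j \notin T ->
    (set_exp a j m - mesym1 T)%MM = set_exp (a - mesym1 T)%MM j m.
Proof.
move=> jT; apply/mnmP => k; rewrite mnmBE !set_expE mnmBE mesym1_mem.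
by case: eqVneq => [->|_] //; rewrite (negbTE jT) subn0.
Qed.

Lemma le_set_exp a j m T : j \notin T ->
    (mesym1 T <= set_exp a j m)%MM = (mesym1 T <= a)%MM.
Proof.
move=> jT; apply/mnm_lepP/mnm_lepP => H k; have := H k; rewrite set_expE mesym1_mem;
by case: eqVneq => [->|_] //; rewrite (negbTE jT).
Qed.

(** The deletions of j in degrees a and a - U_(j) coincide here, so their relative homology, which
    governs [Kos P a], is trivial. *)
Lemma acyclic_flat P j a i : upward P -> (0 < a j)%N ->
  (forall u, u j = a j -> P u -> P (u - U_(j))%MM) -> acyclic R i (Kos P a).
Proof.
move=> Pu aj flat; apply/(acyclic_rel _ Pu aj);
    apply: rel_acyclic_refl => T /and3P[jT Ta PT].
rewrite /Kos_del /Kos jT set_exp_subU le_set_exp // Ta set_exp_subT //=.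
have uj : (a - mesym1 T)%MM j = a j by rewrite mnmBE mesym1_mem (negbTE jT) subn0.
by have := flat _ uj PT; rewrite set_exp_subU uj.
Qed.

(** The deletions grow with the exponent m of x_j; each consecutive pair is acyclic by
    [acyclic_rel], and the filtration telescopes. *)
Lemma rel_acyclic_range P j a i N : upward P ->
  (forall m, (0 < m <= N)%N -> acyclic R i (Kos P (set_exp a j m))) ->
  rel_acyclic R i (Kos_del P j (set_exp a j N)) (Kos_del P j (set_exp a j 0)).
Proof.
move=> Pu; elim: N => [|N IH] H; first exact: rel_acyclic_refl.
have sub m m' T : (m <= m')%N -> Kos_del P j (set_exp a j m) T ->
    Kos_del P j (set_exp a j m') T.
  move=> mm'; apply: Kos_del_sub => // [k kj|]; rewrite !set_expE ?eqxx //.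
  by rewrite (negbTE kj).
apply: (@rel_acyclic_trans _ _ _ _ (Kos_del P j (set_exp a j N))).
- by move=> T; apply: sub.
- by move=> T; apply: sub.
- have aj : (0 < set_exp a j N.+1 j)%N by rewrite set_expE eqxx.
  have /(acyclic_rel _ Pu aj) := H N.+1 (leqnn _).
  by rewrite set_exp_subU set_exp_set_exp set_expE eqxx.
- by apply: IH => m /andP[m0 mN]; apply: H; rewrite m0 ltnW.
Qed.

(** P' is P with the exponent of x_j sent to infinity. The deletions of P' at exponents 1 and 0 are
    those of P at exponents N and 0 for large N, so one step for P' is a filtration of length N for
    P. *)
Lemma acyclic_radical_step P P' j a i : upward P -> upward P' -> a j = 1%N ->
  (forall u, u j = 0%N -> P' u = P u) ->
  (forall u, (0 < u j)%N -> P' u <-> exists m, P (set_exp u j m)) ->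
  (forall m, (0 < m)%N -> acyclic R i (Kos P (set_exp a j m))) -> acyclic R i (Kos P' a).
Proof.
move=> Pu P'u aj P0 P1 H.
have /fin_all_exists[f fP] T : exists m, Kos_del P' j a T ->
    P (set_exp (a - mesym1 T)%MM j m).
  have [/and3P[jT Ta PT]|] := boolP (Kos_del P' j a T); last by exists 0%N.
  have /P1 : (0 < (a - mesym1 T)%MM j)%N by rewrite mnmBE mesym1_mem (negbTE jT) aj.
  by case=> /(_ PT)[m Pm] _; exists m.
(* There are finitely many faces, so a single exponent serves all of them. *)
pose N := \max_T f T.
have aj0 : (0 < a j)%N by rewrite aj.
apply/(acyclic_rel _ P'u aj0).
apply: eq_rel_acyclic (@rel_acyclic_range P j a i N Pu _) => [T|T|m /andP[m0 _]];
    last exact: H.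
- have [jT|jT] := boolP (j \in T); first by rewrite /Kos_del jT.
  have pos : (0 < (a - mesym1 T)%MM j)%N by rewrite mnmBE mesym1_mem (negbTE jT) aj.
  apply/idP/idP.
    rewrite /Kos_del /Kos jT le_set_exp // set_exp_subT //= => /andP[Ta PT];
        rewrite Ta /=.
    by apply/P1 => //; exists N.
  move=> KT; have := fP _ KT; rewrite /Kos_del /Kos jT le_set_exp // set_exp_subT //=.
  have /and3P[_ -> _] := KT; apply: Pu; apply/mnm_lepP => k; rewrite !set_expE.
  by case: eqP => // _; apply: leq_bigmax.
- have [jT|jT] := boolP (j \in T); first by rewrite /Kos_del jT.
  rewrite /Kos_del /Kos set_exp_subU aj /= le_set_exp // set_exp_subT // P0 //.
  by rewrite set_expE eqxx.
Qed.
End UpperKoszul.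

(** * Radicals and localisations *)

Section Radical.
Variables (R : comNzRingType) (n : nat).
Implicit Types (P : pred 'X_{1..n}) (a u v : 'X_{1..n}) (T : {set 'I_n}).

Definition scale_exp (J : {set 'I_n}) N u : 'X_{1..n} :=
  [multinom if j \in J then (N * u j)%N else u j | j < n].

Lemma scale_expE J N u j : scale_exp J N u j = if j \in J then (N * u j)%N else u j.
Proof. exact: mnmE. Qed.

(** The radical in the variables of J only: [setT] gives the full radical, [set0] gives P back, and
    removing one variable from J is one step of the descent. *)
Definition partial_radical (J : {set 'I_n}) P : pred 'X_{1..n} :=
  fun u => `[< exists N, P (scale_exp J N u) >].

Lemma upward_partial_radical J P : upward P -> upward (partial_radical J P).
Proof.
move=> Pu u v /mnm_lepP uv /asboolP[N PN]; apply/asboolP; exists N.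
apply: Pu PN; apply/mnm_lepP => k; rewrite !scale_expE.
by case: ifP => // _; rewrite leq_mul2l uv orbT.
Qed.

Lemma partial_radical0 P : partial_radical set0 P =1 P.
Proof.
move=> u; have E N : scale_exp set0 N u = u by apply/mnmP => k; rewrite scale_expE inE.
by apply/asboolP/idP => [[N]|Pu]; [rewrite E|exists 0%N; rewrite E].
Qed.

Lemma partial_radical_step0 P (J : {set 'I_n}) j u : u j = 0%N ->
    partial_radical J P u = partial_radical (J :\ j) P u.
Proof.
move=> uj; have E N : scale_exp J N u = scale_exp (J :\ j) N u.
  by apply/mnmP => k; rewrite !scale_expE !inE; case: eqVneq => [->|] //;
      rewrite uj muln0 if_same.
by apply/asboolP/asboolP => -[N PN]; exists N; rewrite ?E // -E.
Qed.

Lemma partial_radical_step1 P (J : {set 'I_n}) j u : upward P -> j \in J -> (0 < u j)%N ->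
  partial_radical J P u <-> exists m, partial_radical (J :\ j) P (set_exp u j m).
Proof.
move=> Pu jJ uj; split=> [/asboolP[N PN]|[m /asboolP[N PN]]].
  exists (N * u j)%N; apply/asboolP; exists N; apply: Pu PN; apply/mnm_lepP => k.
  by rewrite !scale_expE !inE set_expE; case: eqVneq => [->|] //; rewrite jJ.
(* As u j is at least 1, the factor N + m reaches m at j and dominates N elsewhere. *)
apply/asboolP; exists (N + m)%N; apply: Pu PN; apply/mnm_lepP => k.
rewrite !scale_expE !inE set_expE; case: eqVneq => [->|_] /=; first by rewrite jJ; nia.
by case: ifP => // _; nia.
Qed.

Lemma radical_descent P a i : upward P -> (forall j, (a j <= 1)%N) ->
  ~ acyclic R i (Kos (partial_radical setT P) a) ->
  exists2 a' : 'X_{1..n}, (forall j, (a' j == 0%N) = (a j == 0%N)) & ~ acyclic R i (Kos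
      P a').
Proof.
move=> Pu a1 H.
(* Invariant along the list: its variables have been treated, the others still carry the radical,
   and there a' agrees with a. *)
have [a' [ha' _ nac]] : exists a' : 'X_{1..n}, [/\ forall j, (a' j == 0%N) = (a j == 0%N),
    forall j, j \notin enum 'I_n -> a' j = a j &
    ~ acyclic R i (Kos (partial_radical [set j | j \notin enum 'I_n] P) a')].
  elim: (enum 'I_n) => [|j s [a' [ha' ea nac]]].
    by exists a; split=> //; rewrite (_ : [set _ | _] = setT) //; apply/setP=> k;
        rewrite !inE.
  have [js|js] := boolP (j \in s).
    exists a'; split=> // [k|]; first by rewrite inE negb_or => /andP[_]; apply: ea.
    rewrite (_ : [set _ | _] = [set j | j \notin s]) //.
    by apply/setP=> k; rewrite !inE; case: eqVneq => [->|] //=; rewrite js.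
  set J := [set j | j \notin s] in nac.
  have -> : [set k | k \notin j :: s] = J :\ j by apply/setP=> k; rewrite !inE negb_or.
  have jJ : j \in J by rewrite inE.
  (* If x_j does not divide the degree, it occurs in no monomial tested by the complex, so dropping
     j from J changes nothing. *)
  have [aj|aj] := posnP (a j).
    exists a'; split=> // [k|]; first by rewrite inE negb_or => /andP[_]; apply: ea.
    move=> ac; apply: nac; apply: eq_rel_acyclic ac => T //; rewrite /Kos.
    case: (boolP (_ <= _)%MM) => //= /mnm_lepP/(_ j) _.
    by rewrite -partial_radical_step0 // mnmBE ea // aj.
  have a'j : a' j = 1%N by rewrite ea //; have := a1 j; lia.
  have [m m0 nac'] : exists2 m, (0 < m)%N & ~ acyclic R i (Kos (partial_radical (J :\
      j) P) (set_exp a' j m)).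
    apply: contrapT => Hm; apply: nac.
    apply: (@acyclic_radical_step _ _ (partial_radical (J :\ j) P) _ j) => //;
        try exact: upward_partial_radical.
    - by move=> u uj; apply: partial_radical_step0.
    - by move=> u uj; apply: partial_radical_step1.
    - by move=> m m0; apply: contrapT => nac'; apply: Hm; exists m.
  exists (set_exp a' j m); split=> // k.
    rewrite set_expE; case: (eqVneq k j) => [->|_]; last exact: ha'.
    by move: m0 aj; case: (m) (a j) => [|?] [].
  by rewrite inE negb_or set_expE => /andP[/negbTE-> /ea ->].
exists a' => // ac; apply: nac; apply: eq_rel_acyclic ac => // T; rewrite /Kos;
    congr andb.
rewrite (_ : [set _ | _] = set0) ?partial_radical0 //.
by apply/setP=> k; rewrite !inE mem_enum.
Qed.

Definition sqfree P := forall u v, (forall j, (u j == 0%N) = (v j == 0%N)) -> P u -> P v.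

(** Lowering an exponent that is at least 2 keeps the support, so [acyclic_flat] applies. *)
Lemma acyclic_sqfree P a i j : upward P -> sqfree P -> (1 < a j)%N ->
    acyclic R i (Kos P a).
Proof.
move=> Pu sP aj; apply: (@acyclic_flat _ _ _ j); rewrite ?(ltnW aj) // => u uj.
apply: sP => k; rewrite mnmBE mnm1E; case: (eqVneq j k) => [<-|_] /=; lia.
Qed.

Lemma mdegDU a j : mdeg (a + U_(j))%MM = (mdeg a).+1.
Proof. by rewrite mdegD mdeg1 addn1. Qed.

Lemma Kos_del_id P a j : a j = 0%N -> Kos_del P j a =1 Kos P a.
Proof.
move=> aj T; rewrite /Kos_del; case: (boolP (Kos P a T)); rewrite ?andbF // andbT.
by case/andP => /mnm_lepP/(_ j); rewrite mesym1_mem aj; case: (j \in T).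
Qed.

(** The shift by U_(j) is the colon by x_j; for squarefree P it is the localisation at x_j. *)
Lemma Kos_del_loc P a j : a j = 0%N ->
  Kos_del P j (a + U_(j))%MM =1 Kos (fun u => P (u + U_(j))%MM) a.
Proof.
move=> aj; have -> : (a + U_(j))%MM = set_exp a j 1.
  by apply/mnmP => k; rewrite mnmDE mnm1E set_expE (eq_sym j k); case: eqVneq => [->|];
      rewrite ?aj ?addn0.
move=> T; rewrite -(Kos_del_id _ aj) /Kos_del; have [//|jT] := boolP (j \in T).
rewrite /Kos /= le_set_exp // set_exp_subT //; congr (_ && P _).
apply/mnmP => k; rewrite set_expE mnmDE mnm1E (eq_sym j k).
by case: eqVneq => [->|]; rewrite ?addn0 // mnmBE aj.
Qed.

Lemma acyclic_locP P a i j : upward P -> a j = 0%N ->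
  acyclic R i (Kos P (a + U_(j))%MM) <->
  rel_acyclic R i (Kos (fun u => P (u + U_(j))%MM) a) (Kos P a).
Proof.
move=> Pu aj; have aj1 : (0 < (a + U_(j))%MM j)%N by rewrite mnmDE mnm1E eqxx addn1.
have aU : (a + U_(j) - U_(j))%MM = a by apply/mnmP => k; rewrite mnmBE mnmDE addnK.
split=> [/(acyclic_rel _ _ Pu aj1) H|H].
  by apply: eq_rel_acyclic H => T; rewrite ?Kos_del_loc ?aU ?Kos_del_id.
apply/(acyclic_rel _ _ Pu aj1).
by apply: eq_rel_acyclic H => T; rewrite ?Kos_del_loc ?aU ?Kos_del_id.
Qed.

Lemma Kos_loc_sub P a j T : upward P -> Kos P a T -> Kos (fun u => P (u + U_(j))%MM) a T.
Proof.
move=> Pu /andP[Ta PT]; rewrite /Kos Ta; apply: Pu PT.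
by apply/mnm_lepP => k; rewrite mnmDE leq_addr.
Qed.

(** P in degrees a and a + U_(j) and its colon by x_j in degree a form one long exact sequence; this
    lemma and the next use exactness at two of its spots. *)
Lemma acyclic_loc P a i j : upward P -> a j = 0%N ->
  acyclic R i (Kos P a) -> acyclic R i (Kos P (a + U_(j))%MM) ->
  acyclic R i (Kos (fun u => P (u + U_(j))%MM) a).
Proof.
move=> Pu aj H1 /(acyclic_locP _ Pu aj) H2; apply: rel_acyclic_trans H2 H1 => // T.
exact: Kos_loc_sub.
Qed.

Lemma acyclic_unloc P a i j : upward P -> a j = 0%N ->
  acyclic R i.+1 (Kos P (a + U_(j))%MM) ->
      acyclic R i (Kos (fun u => P (u + U_(j))%MM) a) ->
  acyclic R i (Kos P a).
Proof.
move=> Pu aj /(acyclic_locP _ Pu aj) H1 H2; apply: acyclic_sub H1 H2 => T.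
exact: Kos_loc_sub.
Qed.

(* s is the top value of mdeg b - i over the nonzero Koszul homology of P, and
   among the degrees attaining it none is bigger than a. *)
Definition extremal P s a := forall b i, ~ acyclic R i (Kos P b) ->
  (mdeg b <= i + s)%N /\ (mdeg b = i + s -> mdeg b <= mdeg a)%N.

Lemma extremal_loc P s a i j : upward P -> sqfree P -> a j = 0%N ->
  mdeg a = (i + s)%N -> extremal P s a -> ~ acyclic R i (Kos P a) ->
  [/\ upward (fun u => P (u + U_(j))%MM), sqfree (fun u => P (u + U_(j))%MM),
      extremal (fun u => P (u + U_(j))%MM) s a &
      ~ acyclic R i (Kos (fun u => P (u + U_(j))%MM) a)].
Proof.
move=> Pu sP aj da ext nac.
have up : upward (fun u => P (u + U_(j))%MM).
  move=> u v /mnm_lepP uv; apply: Pu; apply/mnm_lepP => k.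
  by rewrite !mnmDE leq_add2r.
have sq : sqfree (fun u => P (u + U_(j))%MM).
  by move=> u v uv; apply: sP => k; rewrite !mnmDE !addn_eq0 uv.
split=> //.
  move=> b i' nacb; have [bj|bj] := posnP (b j); last first.
    (* The localised ideal does not see the exponent of x_j. *)
    case: nacb; apply: (@acyclic_flat _ _ _ j) => // u uj.
    apply: sP => k; rewrite !mnmDE mnmBE mnm1E; case: (eqVneq j k) => [<-|_] /=; lia.
  have [|ac] := pselect (~ acyclic R i' (Kos P b)); first exact: ext.
  (* A class in degree b + U_(j) makes mdeg b strictly smaller than i' + s, which gives both
     bounds. *)
  have [|ac'] := pselect (~ acyclic R i' (Kos P (b + U_(j))%MM)).
    by move=> /ext; rewrite mdegDU; lia.
  by case: nacb; apply: acyclic_loc => //; apply: contrapT.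
move=> ac; apply: nac; apply: acyclic_unloc ac => //.
(* A class of size i + 1 in degree a + U_(j) would attain s in a degree bigger than a. *)
by apply: contrapT => /ext; rewrite mdegDU; lia.
Qed.

(** Localise at all variables outside the support of a. If their product were in P, this would give
    the unit ideal, which has no Koszul homology in degrees other than 0; and in degree 0 the
    complex of P itself has no face, as 1 is not in P. *)
Lemma extremal_nonface P s a i : upward P -> sqfree P -> ~~ P 0%MM ->
  mdeg a = (i + s)%N -> extremal P s a -> ~ acyclic R i (Kos P a) ->
  ~~ P (mesym1 [set j | a j == 0%N]).
Proof.
move=> Pu sP P0 da ext nac.
set F := [set j | a j == 0%N].
pose m s := (\sum_(j <- s) U_(j))%MM : 'X_{1..n}.
have loc Q t : upward Q -> sqfree Q -> extremal Q s a -> ~ acyclic R i (Kos Q a) ->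
    {in t, forall j, a j = 0%N} -> ~ acyclic R i (Kos (fun u => Q (u + m t)%MM) a).
  elim: t Q => [|j t IH] Q Qu Qs Qe Qn at0.
    move=> ac; apply: Qn; apply: eq_rel_acyclic ac => // T; rewrite /Kos /m big_nil /=.
    by congr (_ && Q _); apply/mnmP => k; rewrite mnmDE mnm0E addn0.
  have [Q'u Q's Q'e Q'n] := extremal_loc Qu Qs (at0 j (mem_head _ _)) da Qe Qn.
  have at0' : {in t, forall j, a j = 0%N} by move=> k kt; apply: at0; rewrite inE kt orbT.
  move=> ac; apply: (IH _ Q'u Q's Q'e Q'n at0').
  apply: eq_rel_acyclic ac => // T; rewrite /Kos /m big_cons /=.
  by congr (_ && Q _); apply/mnmP => k; rewrite !mnmDE addnA addnAC.
apply/negP => PF.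
apply: (loc P (enum F)) => // [j|]; first by rewrite mem_enum inE => /eqP.
have PT u : P (u + m (enum F))%MM.
  have : P (m (enum F)).
    apply: sP PF => j; rewrite mesym1_mem /m mnm_sumE sum_nat_seq_eq0.
    apply/idP/idP.
      rewrite eqb0 => jF; apply/allP => k; rewrite mem_enum /= mnm1E => kF.
      by case: (eqVneq k j) jF => [<-|//]; rewrite kF.
    move/allP => H; rewrite eqb0; apply/negP => jF.
    by have := H j; rewrite mem_enum jF mnm1E eqxx => /(_ isT).
  by apply: Pu; apply/mnm_lepP => k; rewrite mnmDE leq_addl.
have [[j aj]|a0] := pselect (exists j, (0 < a j)%N).
    by apply: (@acyclic_flat _ _ _ j) => // u _ _; apply: PT.
have a00 : a = 0%MM.
  by apply/mnmP => k; rewrite mnm0E; apply/eqP; rewrite -leqn0 leqNgt; apply/negP => ?;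
      apply: a0; exists k.
case: nac; move=> c hc _; exists 0, 0; split; try exact: csupp0.
rewrite bdry0 add0r; apply/ffunP => T; rewrite [RHS]ffunE; apply/eqP; apply: contraT.
move=> /hc[/andP[_ PTT] _]; case/negP: P0; apply: Pu PTT; rewrite a00.
by apply/mnm_lepP => k; rewrite mnmBE mnm0E.
Qed.

(** Degrees with nonzero homology are squarefree, hence of total degree at most n, so a largest one
    exists. *)
Lemma extremal_exists P s a0 i0 : upward P -> sqfree P ->
  (forall b i, ~ acyclic R i (Kos P b) -> (mdeg b <= i + s)%N) ->
  mdeg a0 = (i0 + s)%N -> ~ acyclic R i0 (Kos P a0) ->
  exists a i, [/\ mdeg a = (i + s)%N, extremal P s a & ~ acyclic R i (Kos P a)].
Proof.
move=> Pu sP bound da0 nac0.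
pose A d := `[< exists a i, [/\ mdeg a = d, mdeg a = (i + s)%N & ~ acyclic R i (Kos P
    a)] >].
have exA : exists d, A d by exists (mdeg a0); apply/asboolP; exists a0, i0.
have bA d : A d -> (d <= n)%N.
  move=> /asboolP[a [i [<- _ nac]]]; rewrite mdegE -[X in (_ <= X)%N]card_ord -sum1_card.
  apply: leq_sum => j _; rewrite leqNgt; apply/negP => aj.
  by apply: nac; apply: acyclic_sqfree aj.
case: (ex_maxnP exA bA) => d /asboolP[a [i [ad ai nac]]] dmax.
exists a, i; split=> // b i' nacb; split; first exact: bound.
by move=> bi; rewrite ad; apply: dmax; apply/asboolP; exists b, i'.
Qed.
End Radical.

(** * The Koszul complex of the variables *)

Section KoszulMatrix.
Variables (K : fieldType) (n : nat).
Local Notation S := {mpoly K[n]}.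
Local Notation N := #|{set 'I_n}|.
Local Notation ev := (@enum_val {set 'I_n} {set 'I_n}).
Local Notation er := (@enum_rank {set 'I_n}).
Implicit Types (a u m : 'X_{1..n}) (T : {set 'I_n}).

Lemma mcoeffXM u (p : S) m :
  ('X_[u] * p)@_m = if (u <= m)%MM then p@_(m - u) else 0.
Proof.
rewrite mulrC; case: ifP => um; first by rewrite -{1}(submK um) addmC mcoeffMX.
apply/eqP; rewrite mcoeff_eq0 (perm_mem (msuppMX _ _)).
by apply/mapP => -[v _ mE]; rewrite mE lem_addr in um.
Qed.

(** The Koszul differential in all sizes at once. It acts on the left, which leaves the right side
    to the matrices of a resolution. *)
Definition koszul_mx : 'M[S]_N := \matrix_(i, j)
  \sum_(t | (t \notin ev i) && (ev j == t |: ev i)) (-1) ^+ sg t (ev i) *: 'X_t.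

Lemma koszul_mxE r (y : 'M[S]_(N, r)) T k : (koszul_mx *m y) (er T) k =
  \sum_(t | t \notin T) (-1) ^+ sg t T *: ('X_t * y (er (t |: T)) k).
Proof.
rewrite mxE (eq_bigr (fun j => \sum_(t | (t \notin T) && (ev j == t |: T))
   (-1) ^+ sg t T *: ('X_t * y j k))) => [|j _]; last first.
  by rewrite mxE enum_rankK mulr_suml; apply: eq_bigr => t _; rewrite scalerAl.
rewrite (exchange_big_dep (fun t => t \notin T)) /=; last by move=> j t _ /andP[].
apply: eq_bigr => t tT; rewrite (big_pred1 (er (t |: T))) // => j.
by rewrite /= tT /= -(inj_eq enum_val_inj) enum_rankK.
Qed.

(* The strand in multidegree a, with e_T in multidegree mesym1 T. *)
Definition mcomp a (z : 'cV[S]_N) : {ffun {set 'I_n} -> K} :=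
  [ffun T => if (mesym1 T <= a)%MM then (z (er T) 0)@_(a - mesym1 T) else 0].

Lemma mcomp_koszul_mx a z : mcomp a (koszul_mx *m z) = bdry (mcomp a z).
Proof.
apply/ffunP=> T; rewrite ffunE bdryE koszul_mxE raddf_sum /=.
have aU t : t \notin T -> (mesym1 (t |: T) <= a)%MM =
    (mesym1 T <= a)%MM && (U_(t) <= a - mesym1 T)%MM.
  move=> tT; apply/mnm_lepP/andP => [H|[/mnm_lepP H1 /mnm_lepP H2] k].
    split; apply/mnm_lepP => k; have := H k; rewrite ?mnmBE ?mnm1E !mesym1_mem !inE.
      by case: (k \in T); rewrite ?orbT.
    by rewrite (eq_sym k t); case: (eqVneq t k) => [<-|_] //=; rewrite (negbTE tT); lia.
  have := H1 k; have := H2 k; rewrite mnmBE mnm1E !mesym1_mem !inE (eq_sym k t).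
  by case: (eqVneq t k) => [<-|_] //=; rewrite (negbTE tT) subn0.
case: ifP => Ta; last first.
  by rewrite big1 // => t tT; rewrite ffunE aU // Ta mulr0.
apply: eq_bigr => t tT; rewrite /= mcoeffZ mcoeffXM ffunE aU // Ta /=; congr (_ * _).
case: ifP => // _; congr (_ @_ _); apply/mnmP => k.
rewrite !mnmBE mnm1E !mesym1_mem !inE (eq_sym k t) -subnDA; congr (_ - _)%N.
by case: (eqVneq t k) => [<-|_] //=; rewrite ?(negbTE tT) ?addn0.
Qed.

Lemma mcoeff_mcomp (z : 'cV[S]_N) T m : (z (er T) 0)@_m = mcomp (m + mesym1 T) z T.
Proof.
rewrite ffunE lem_addl (_ : _ - _ = m)%MM //.
by apply/mnmP => k; rewrite mnmBE mnmDE addnK.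
Qed.

Lemma mcomp_inj (y z : 'cV[S]_N) : (forall a, mcomp a y = mcomp a z) -> y = z.
Proof.
move=> H; apply/matrixP => i k; rewrite (ord1 k) -(enum_valK i); apply/mpolyP => m.
by rewrite !mcoeff_mcomp H.
Qed.

Lemma mcomp0 a : mcomp a 0 = 0.
Proof. by apply/ffunP=> T; rewrite !ffunE mxE mcoeff0 if_same. Qed.

Lemma koszul_mxK r (y : 'M[S]_(N, r)) : koszul_mx *m (koszul_mx *m y) = 0.
Proof.
apply/matrixP => i k; rewrite [RHS]mxE.
have -> : (koszul_mx *m (koszul_mx *m y)) i k = (koszul_mx *m (koszul_mx *m col k y)) i 0.
  rewrite !mxE; apply: eq_bigr => t _; congr (_ * _); rewrite !mxE.
  by apply: eq_bigr => t' _; congr (_ * _); rewrite mxE.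
rewrite (_ : koszul_mx *m _ = 0) ?mxE //; apply: mcomp_inj => a.
by rewrite !mcomp_koszul_mx bdryK mcomp0.
Qed.

Definition assemble (s : seq 'X_{1..n}) (b : 'X_{1..n} -> {ffun {set 'I_n} ->
    K}) : 'cV[S]_N :=
  \col_i \sum_(a <- s | (mesym1 (ev i) <= a)%MM) b a (ev i) *: 'X_[a - mesym1 (ev i)].

Lemma mcomp_assemble s (b : 'X_{1..n} -> {ffun {set 'I_n} -> K}) a : uniq s ->
  (forall T, b a T != 0 -> (mesym1 T <= a)%MM) ->
  mcomp a (assemble s b) = if a \in s then b a else 0.
Proof.
move=> us hb; apply/ffunP=> T; rewrite ffunE mxE enum_rankK raddf_sum /=.
case: ifP => Ta; last first.
  by case: ifP; rewrite ?ffunE // => _; apply/eqP; rewrite eq_sym;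
      apply: contraFT Ta => /hb.
rewrite (eq_bigr (fun a' => if a' == a then b a' T else 0)) => [|a' Ta']; last first.
  rewrite mcoeffZ mcoeffX (_ : (_ == _) = (a' == a)).
    by case: eqP; rewrite ?mulr1 ?mulr0.
  apply/eqP/eqP => [E|-> //]; rewrite -(submK Ta') -(submK Ta); by rewrite E.
rewrite big_mkcond; case: ifP => as_.
  rewrite (bigD1_seq a) //= Ta eqxx big1 ?addr0 // => a' /negbTE->.
  by rewrite if_same.
rewrite big1_seq ?ffunE // => a' /andP[_ a's]; case: eqP a's => [->|]; rewrite ?as_ //.
by rewrite if_same.
Qed.

(** The strands are solved separately and glued: z has finitely many terms, so only the multidegrees
    in s matter. Q records that the coefficients of the solution stay in a monomial ideal. *)
Lemma koszul_mx_lift (Q : pred 'X_{1..n}) (z : 'cV[S]_N) :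
  (forall a, exists2 b : {ffun {set 'I_n} -> K}, (forall T, b T != 0 ->
      Kos Q a T) & bdry b = mcomp a z) ->
  exists2 w, z = koszul_mx *m w & forall i m, (w i 0)@_m != 0 -> Q m.
Proof.
move=> H.
have /choice[b bP] a : exists b : {ffun {set 'I_n} -> K}, (forall T, b T != 0 ->
    Kos Q a T) /\ bdry b = mcomp a z.
  by have [b] := H a; exists b.
pose s := undup [seq (m + mesym1 T)%MM | T <- enum {set 'I_n}, m <- msupp (z (er T) 0)].
have us : uniq s by apply: undup_uniq.
have bT a T : b a T != 0 -> (mesym1 T <= a)%MM by move/(bP a).1 => /andP[].
exists (assemble s b).
  apply: mcomp_inj => a; rewrite mcomp_koszul_mx mcomp_assemble //; last exact: bT.
  case: ifP => as_; first by rewrite (bP a).2.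
  rewrite bdry0; apply/ffunP=> T; rewrite [RHS]ffunE; apply/eqP; apply: contraFT as_.
  rewrite ffunE; case: ifP => [Ta nz|]; last by rewrite eqxx.
  rewrite mem_undup; apply/allpairsPdep; exists T, (a - mesym1 T)%MM.
  by rewrite mem_enum inE mcoeff_msupp nz submK.
move=> i m; rewrite -(enum_valK i) mcoeff_mcomp mcomp_assemble //; last exact: bT.
case: ifP => [_ /(bP _).1 /andP[_]|]; last by rewrite ffunE eqxx.
by rewrite (_ : _ - _ = m)%MM //; apply/mnmP => k; rewrite mnmBE mnmDE addnK.
Qed.

(** The Koszul complex resolves K. In a multidegree with a j positive, [wedge j] preserves the
    strand and contracts it; in multidegree 0 only the empty set remains, and its coefficient is the
    constant term. *)
Lemma koszul_mx_exact r (y : 'M[S]_(N, r)) : koszul_mx *m y = 0 ->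
  (forall k, (y (er set0) k)@_0%MM = 0) -> exists w, y = koszul_mx *m w.
Proof.
move=> y0 yc.
have /fin_all_exists[w wP] k : exists w, col k y = koszul_mx *m w.
  have [|w wE _] := @koszul_mx_lift predT (col k y); last by exists w.
  have Dk : koszul_mx *m col k y = 0.
    apply/matrixP => i l; have /matrixP/(_ i k) := y0; rewrite !mxE => yik;
        rewrite -[RHS]yik.
    by apply: eq_bigr => t _; congr (_ * _); rewrite mxE.
  move=> a; have [[j aj]|a0] := pselect (exists j, (0 < a j)%N).
    exists (wedge j (mcomp a (col k y))); last first.
      rewrite bdry_wedge -mcomp_koszul_mx Dk mcomp0 (_ : wedge j 0 = 0) ?subr0 //.
      by apply/ffunP=> T; rewrite !ffunE mulr0 if_same.
    move=> T; rewrite ffunE; case: ifP => jT; last by rewrite eqxx.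
    rewrite /Kos andbT ffunE; case: ifP => [/mnm_lepP Ta _|_]; last by rewrite mulr0 eqxx.
    apply/mnm_lepP => l; rewrite mesym1_mem; have := Ta l; rewrite mesym1_mem !inE.
    by case: eqVneq => [->|] //=; rewrite jT.
  have a00 : a = 0%MM.
    apply/mnmP => l; rewrite mnm0E; apply/eqP; rewrite -leqn0 leqNgt; apply/negP => ?.
    by apply: a0; exists l.
  exists 0 => [T|]; first by rewrite ffunE eqxx.
  rewrite bdry0; apply/ffunP=> T; rewrite !ffunE; case: ifP => // Ta.
  have T0 : T = set0.
    apply/setP => l; rewrite inE; have /mnm_lepP/(_ l) := Ta.
    by rewrite mesym1_mem a00 mnm0E; case: (l \in T).
  by rewrite mxE T0 mesym1_set0 a00 (_ : (0 - 0)%MM = 0%MM) ?yc //; apply/mnmP=> l;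
      rewrite mnmBE !mnm0E.
exists (\matrix_(i, k) w k i 0); apply/matrixP => i k.
have /matrixP/(_ i 0) := wP k; rewrite !mxE => ->.
by apply: eq_bigr => t _; congr (_ * _); rewrite mxE.
Qed.
End KoszulMatrix.

(** * Betti numbers and Koszul homology *)

Section Grading.
Variables (K : fieldType) (n : nat).
Local Notation S := {mpoly K[n]}.

Definition hpart (d : int) (p : S) : S :=
  \sum_(m <- msupp p | (mdeg m)%:Z == d) p@_m *: 'X_[m].

Lemma mcoeff_hpart d p m : (hpart d p)@_m = if (mdeg m)%:Z == d then p@_m else 0.
Proof.
rewrite raddf_sum /= big_mkcond /=.
rewrite (eq_bigr (fun m' => if m' == m then if (mdeg m)%:Z == d then p@_m else 0 else
    0)); last first.
  move=> m' _; case: (eqVneq m' m) => [->|m'm].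
    by case: ifP => // _; rewrite mcoeffZ mcoeffX eqxx mulr1.
  by case: ifP => // _; rewrite mcoeffZ mcoeffX (negbTE m'm) mulr0.
have [mp|mp] := boolP (m \in msupp p).
  rewrite (bigD1_seq m) ?msupp_uniq //= eqxx big1 ?addr0 // => m' /negbTE->.
  by [].
rewrite big1_seq => [|m' /andP[_ m'p]]; last by case: eqP m'p => // ->;
    rewrite (negbTE mp).
by move: mp; rewrite -mcoeff_eq0 => /eqP->; rewrite if_same.
Qed.

Lemma homogzP d (p : S) : homogz d p <-> forall m, p@_m != 0 -> (mdeg m)%:Z = d.
Proof. by split=> H m; have := H m; rewrite mcoeff_msupp. Qed.

Lemma hpart_id d p : homogz d p -> hpart d p = p.
Proof.
move=> /homogzP H; apply/mpolyP => m; rewrite mcoeff_hpart; case: eqP => // nd.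
by apply/eqP; rewrite eq_sym; apply/eqP; apply/eqP; apply: contra_notT nd => /H.
Qed.

Lemma homogz_hpart d p : homogz d (hpart d p).
Proof. by apply/homogzP => m; rewrite mcoeff_hpart; case: ifP => [/eqP //|_];
    rewrite eqxx. Qed.

Lemma hpart0 d : hpart d 0 = 0.
Proof. by apply/mpolyP => m; rewrite mcoeff_hpart mcoeff0 if_same. Qed.

Lemma hpartD d p q : hpart d (p + q) = hpart d p + hpart d q.
Proof. by apply/mpolyP => m; rewrite mcoeffD !mcoeff_hpart mcoeffD; case: ifP;
    rewrite ?addr0. Qed.

Lemma hpart_sum (J : finType) d (F : J -> S) :
  hpart d (\sum_i F i) = \sum_i hpart d (F i).
Proof. exact: (big_morph _ (hpartD d) (hpart0 d)). Qed.

Lemma hpartMr d e p q : homogz e q -> hpart (d + e) (p * q) = hpart d p * q.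
Proof.
move=> /homogzP hq; apply/mpolyP => m; rewrite mcoeff_hpart !mcoeffM; case: ifP => md.
  apply: eq_bigr => k /eqP/(congr1 mdeg) mE; rewrite mcoeff_hpart.
  have [->|/hq kd] := eqVneq q@_k.2 0; first by rewrite !mulr0.
  have key : (mdeg m)%:Z = (mdeg k.1)%:Z + e by rewrite -kd -PoszD -mdegD -mE.
  by move: md; rewrite key (inj_eq (addIr e)) => ->.
rewrite big1 // => k /eqP/(congr1 mdeg) mE; rewrite mcoeff_hpart.
have [->|/hq kd] := eqVneq q@_k.2 0; first by rewrite !mulr0.
have key : (mdeg m)%:Z = (mdeg k.1)%:Z + e by rewrite -kd -PoszD -mdegD -mE.
by move: md; rewrite key (inj_eq (addIr e)) => ->; rewrite mul0r.
Qed.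

(** Row i is homogeneous of degree e + s i when the basis vector j has degree t j. *)
Definition homog_mx p q (e : int) (s : 'I_p -> int) (t : 'I_q ->
    int) (A : 'M[S]_(p, q)) :=
  forall i j, homogz (e + s i - t j) (A i j).

Definition homog_proj p q (e : int) (s : 'I_p -> int) (t : 'I_q ->
    int) (A : 'M[S]_(p, q)) :=
  \matrix_(i, j) hpart (e + s i - t j) (A i j).

Lemma homog_proj_id p q e s t (A : 'M_(p, q)) : homog_mx e s t A ->
    homog_proj e s t A = A.
Proof. by move=> H; apply/matrixP => i j; rewrite mxE hpart_id. Qed.

Lemma homog_mx_proj p q e s t (A : 'M_(p, q)) : homog_mx e s t (homog_proj e s t A).
Proof. by move=> i j; rewrite mxE; apply: homogz_hpart. Qed.

(** Homogeneous components commute with multiplication by a degree 0 graded matrix; this lets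
    arbitrary lifts be replaced by homogeneous ones. *)
Lemma homog_projMr p q r e s t u (A : 'M_(p, q)) (B : 'M_(q, r)) :
  homog_mx 0 t u B -> homog_proj e s u (A *m B) = homog_proj e s t A *m B.
Proof.
move=> hB; apply/matrixP => i j; rewrite !mxE hpart_sum; apply: eq_bigr => k _.
rewrite mxE (_ : e + s i - u j = (e + s i - t k) + (0 + t k - u j)); last by ring.
exact: hpartMr.
Qed.

Lemma homog_projMl p q r e s t u (A : 'M_(p, q)) (B : 'M_(q, r)) :
  homog_mx 0 s t A -> homog_proj e s u (A *m B) = A *m homog_proj e t u B.
Proof.
move=> hA; apply/matrixP => i j; rewrite !mxE hpart_sum; apply: eq_bigr => k _.
rewrite mxE (_ : e + s i - u j = (e + t k - u j) + (0 + s i - t k)); last by ring.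
by rewrite mulrC hpartMr // mulrC.
Qed.

Lemma homog_mxM p q r e s t u (A : 'M_(p, q)) (B : 'M_(q, r)) :
  homog_mx e s t A -> homog_mx 0 t u B -> homog_mx e s u (A *m B).
Proof.
move=> hA hB; rewrite -(homog_proj_id hA) -(homog_projMr _ _ _ hB); exact: homog_mx_proj.
Qed.

Lemma homog_mxMl p q r e s t u (A : 'M_(p, q)) (B : 'M_(q, r)) :
  homog_mx 0 s t A -> homog_mx e t u B -> homog_mx e s u (A *m B).
Proof.
move=> hA hB; rewrite -(homog_proj_id hB) -(homog_projMl _ _ _ hA); exact: homog_mx_proj.
Qed.
End Grading.

(** * Comparison of a minimal resolution with the Koszul complex *)

Section Resolution.
Variables (K : fieldType) (n : nat).
Local Notation S := {mpoly K[n]}.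
Local Notation N := #|{set 'I_n}|.
Local Notation ev := (@enum_val {set 'I_n} {set 'I_n}).
Local Notation er := (@enum_rank {set 'I_n}).
Local Notation koszul_mx := (koszul_mx K n).
Implicit Types (a u m : 'X_{1..n}) (T : {set 'I_n}).

(** Row T is the coefficient of e_T, which has degree #|T|; the sign makes the total degree
    constant. *)
Definition row_shift (i : 'I_N) : int := - (#|ev i|%:Z).

Lemma homog_koszul_mx : homog_mx 0 row_shift row_shift koszul_mx.
Proof.
move=> i j; rewrite mxE /row_shift; apply/homogzP => m; rewrite raddf_sum /=.
have [[t /andP[tT /eqP jE]]|H] := pselect (exists t, (t \notin ev i) && (ev j == t |:
    ev i)); last first.
  by rewrite big1 ?eqxx // => t tP; case: H; exists t.
rewrite (bigD1 t) /= ?tT ?jE ?eqxx // big1 ?addr0.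
  rewrite mcoeffZ mcoeffX; case: (eqVneq U_(t)%MM m) => [<- _|_];
      last by rewrite mulr0 eqxx.
  by rewrite mdeg1 cardsU1 tT sub0r opprK PoszD addrC addrK.
move=> t' /andP[/andP[t'T /eqP E] /negP[]].
by have := setU11 t' (ev i); rewrite -E !inE (negbTE t'T) orbF.
Qed.

Definition rows (q : nat) : 'M[S]_N := diag_mx (\row_i (#|ev i| == q)%:R).

Definition sized q r (y : 'M[S]_(N, r)) := forall i k, y i k != 0 -> #|ev i| = q.

Lemma rowsE q r (y : 'M[S]_(N, r)) i k :
  (rows q *m y) i k = if #|ev i| == q then y i k else 0.
Proof. by rewrite mul_diag_mx !mxE; case: eqP; rewrite ?mul1r ?mul0r. Qed.

Lemma sized_rows q r (y : 'M[S]_(N, r)) : sized q (rows q *m y).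
Proof. by move=> i k; rewrite rowsE; case: ifP => [/eqP //|_]; rewrite eqxx. Qed.

Lemma rows_id q r (y : 'M[S]_(N, r)) : sized q y -> rows q *m y = y.
Proof.
move=> sy; apply/matrixP => i k; rewrite rowsE; case: eqP => // nq.
by apply/eqP; rewrite eq_sym; apply: contra_notT nq => /sy.
Qed.

Lemma sizedM q r r' (y : 'M[S]_(N, r)) (M : 'M[S]_(r, r')) : sized q y ->
    sized q (y *m M).
Proof. by move=> /rows_id <-; rewrite -mulmxA; apply: sized_rows. Qed.

Lemma koszul_mx_rows q : koszul_mx *m rows q.+1 = rows q *m koszul_mx.
Proof.
apply/matrixP => i j; rewrite rowsE mul_mx_diag !mxE.
have [[t /andP[tT /eqP jE]]|H] := pselect (exists t, (t \notin ev i) && (ev j == t |: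
    ev i)); last first.
  by rewrite big1 ?mul0r ?if_same // => t tP; case: H; exists t.
by rewrite jE cardsU1 tT add1n eqSS; case: eqP; rewrite ?mulr1 ?mulr0.
Qed.

Lemma sized_koszul_mx q r (y : 'M[S]_(N, r)) : sized q.+1 y -> sized q (koszul_mx *m y).
Proof. by move=> /rows_id <-; rewrite mulmxA koszul_mx_rows -mulmxA;
    apply: sized_rows. Qed.

Lemma koszul_mx_sized0 r (y : 'M[S]_(N, r)) : sized 0 y -> koszul_mx *m y = 0.
Proof.
move=> sy; apply/matrixP => i k; rewrite -(enum_valK i) koszul_mxE mxE big1 // => t tT.
have [->|/sy] := eqVneq (y (er (t |: ev i)) k) 0; first by rewrite mulr0 scaler0.
by rewrite enum_rankK cardsU1 tT.
Qed.

Lemma mcoeffM0 (p q : S) : (p * q)@_0%MM = p@_0%MM * q@_0%MM.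
Proof. exact: (rmorphM (mcoeff 0%MM)). Qed.

Lemma mx_const0 p q r (A : 'M[S]_(p, q)) (B : 'M[S]_(q, r)) i k :
  (forall l, (A i l)@_0%MM = 0) \/ (forall l, (B l k)@_0%MM = 0) ->
      ((A *m B) i k)@_0%MM = 0.
Proof.
by move=> H; rewrite mxE raddf_sum big1 //= => l _; rewrite mcoeffM0;
  case: H => ->; rewrite ?mul0r ?mulr0.
Qed.

Lemma koszul_mx_const0 r (w : 'M[S]_(N, r)) i k : ((koszul_mx *m w) i k)@_0%MM = 0.
Proof.
apply: mx_const0; left => l; rewrite mxE raddf_sum big1 //= => t _.
by rewrite mcoeffZ mcoeffX mnm1_eq0 mulr0.
Qed.

Variables (I : {pred S}) (F : free_complex K n).
Hypothesis F_res : minimal_graded_free_resolution F I.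

Definition killed p : 'M[S]_(N, frank F p) -> Prop :=
  match p with
  | 0 => fun v => v *m faug F = 0
  | p'.+1 => fun v => v *m fdiff F p' = 0
  end.

Lemma killedP p (v : 'M[S]_(N, frank F p)) : killed v <-> exists w, v = w *m fdiff F p.
Proof.
have [_ [_ ex0 exS] _] := F_res.
have main (m : nat) (M : 'M[S]_(frank F p, m)) :
    (forall v : 'rV_(frank F p), v *m M = 0 <-> exists w, v = w *m fdiff F p) ->
    v *m M = 0 <-> exists w, v = w *m fdiff F p.
  move=> H; split=> [vM|[w ->]].
    have /fin_all_exists[w wP] i : exists w, row i v = w *m fdiff F p.
      by apply/H; rewrite -row_mul vM row0.
    exists (\matrix_i w i); apply/row_matrixP => i; rewrite row_mul rowK; exact: wP.
  apply/row_matrixP => i; rewrite row0 -mulmxA row_mul mulmxA; apply/H.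
  by exists (row i w).
by case: p v main => [|p] v main; apply: main; [apply: ex0|apply: exS].
Qed.

Lemma homog_fdiff p : homog_mx 0 (@fshift _ _ F p.+1) (@fshift _ _ F p) (fdiff F p).
Proof. by move=> k l; have [[_ gr] _ _] := F_res; rewrite add0r; apply: gr. Qed.

Lemma homog_faug : homog_mx 0 (@fshift _ _ F 0) (fun _ => 0) (faug F).
Proof. by move=> k l; have [[gr _] _ _] := F_res; rewrite add0r subr0 (ord1 l);
    apply: gr. Qed.

Lemma killed_fdiff p (w : 'M_(N, frank F p.+1)) : killed (w *m fdiff F p).
Proof. by apply/killedP; exists w. Qed.

(** Any lift is corrected by projecting to Koszul size q and to degree e; both projections commute
    with [fdiff]. *)
Lemma killed_lift p (e : int) q (v : 'M_(N, frank F p)) : killed v ->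
  homog_mx e row_shift (@fshift _ _ F p) v -> sized q v ->
  exists w, [/\ v = w *m fdiff F p, homog_mx e row_shift (@fshift _ _ F p.+1) w & sized
      q w].
Proof.
move=> /killedP[w vE] hv sv.
exists (homog_proj e row_shift (@fshift _ _ F p.+1) (rows q *m w)); split.
- rewrite -(homog_projMr _ _ _ (@homog_fdiff p)) -mulmxA -vE rows_id //.
  by rewrite homog_proj_id.
- exact: homog_mx_proj.
- by move=> i k; rewrite mxE rowsE; case: ifP => [/eqP //|_]; rewrite hpart0 eqxx.
Qed.

Lemma koszul_mx_lift_graded r (e : int) (t : 'I_r ->
    int) q (v : 'M_(N, r)) : koszul_mx *m v = 0 ->
  (forall k, (v (er set0) k)@_0%MM = 0) -> homog_mx e row_shift t v -> sized q v ->
  exists w, [/\ v = koszul_mx *m w, homog_mx e row_shift t w & sized q.+1 w].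
Proof.
move=> Dv v0 hv sv; have [w vE] := koszul_mx_exact Dv v0.
exists (homog_proj e row_shift t (rows q.+1 *m w)); split.
- by rewrite -(homog_projMl _ _ _ homog_koszul_mx) mulmxA koszul_mx_rows -mulmxA -vE
    rows_id // homog_proj_id.
- exact: homog_mx_proj.
- by move=> i k; rewrite mxE rowsE; case: ifP => [/eqP //|_]; rewrite hpart0 eqxx.
Qed.

(* Elements of F_p (x) Koszul_q; rows are indexed by subsets, so the Koszul
   differential acts on the left and that of F on the right. Sliding along
   p + q = i compares generators of F_i with Koszul homology of I in size i. *)
Definition zigzag p q (e : int) (y : 'M[S]_(N, frank F p)) :=
  [/\ homog_mx e row_shift (@fshift _ _ F p) y, sized q y & killed (koszul_mx *m y)].

Definition trivial_zigzag p (y : 'M[S]_(N, frank F p)) :=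
  exists w w', y = koszul_mx *m w + w' *m fdiff F p.

(** Induction on q: the Koszul boundary of y lifts through F to a zigzag one step further in F and
    one size lower, which is trivial by induction. *)
Lemma zigzag_trivial p q e : betti F (p + q) e = 0%N ->
  forall y, zigzag (p := p) q e y -> trivial_zigzag y.
Proof.
elim: q p => [|q IH] p b0 y [hy sy ky].
  have [|w ->] := koszul_mx_exact (koszul_mx_sized0 sy); last first.
    by exists w, 0; rewrite mul0mx addr0.
  (* A nonzero constant term in row [set0] would come from a generator of F_p in degree e. *)
  move=> k; apply/eqP; apply: contraT => nz.
  have /homogzP/(_ _ nz) := hy (er set0) k.
  rewrite mdeg0 /row_shift enum_rankK cards0 oppr0 addr0 => /eqP;
      rewrite eq_sym subr_eq0 => /eqP ek.
  by move: b0; rewrite addn0 => /card0_eq/(_ k); rewrite !inE ek eqxx.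
have [||w [vE hw sw]] := @killed_lift p e q _ ky.
- exact: homog_mxMl homog_koszul_mx hy.
- exact: sized_koszul_mx.
have [||w1 [w2 wE]] := IH p.+1 _ w.
- by rewrite addSnnS.
- split=> //.
  by rewrite /= -mulmxA -vE koszul_mxK.
have minF i k l : (fdiff F i k l)@_0%MM = 0 by have [_ _ H] := F_res; apply: H.
(* Subtracting [w1 *m fdiff F p] makes y a Koszul cycle, and minimality keeps the constant terms
   zero. *)
have [||w0 E] := @koszul_mx_exact _ _ _ (y - w1 *m fdiff F p).
- rewrite mulmxBr vE wE mulmxDl mulmxA addrC addKr.
  by have := killed_fdiff w2.
- move=> k; rewrite mxE mcoeffD mxE mcoeffN mx_const0 ?subr0; last by right.
  have [->|/sy] := eqVneq (y (er set0) k) 0; first by rewrite mcoeff0.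
  by rewrite enum_rankK cards0.
by exists w0, w1; rewrite -E subrK.
Qed.

(** The slide towards F_0: [y *m fdiff F p] is a Koszul cycle without constant terms, by minimality,
    hence a Koszul boundary of some y'. A trivialisation of y' yields one of y. *)
Lemma slide_zigzag p q e (y : 'M_(N, frank F p.+1)) : zigzag q e y ->
    ~ trivial_zigzag y ->
  exists2 y', zigzag (p := p) q.+1 e y' & ~ trivial_zigzag y'.
Proof.
move=> [hy sy ky] nb.
have minF i k l : (fdiff F i k l)@_0%MM = 0 by have [_ _ H] := F_res; apply: H.
have [||||y' [vE hy' sy']] := @koszul_mx_lift_graded _ e (@fshift _ _ F p) q (y *m
    fdiff F p).
- by rewrite mulmxA; apply: ky.
- by move=> k; apply: mx_const0; right.
- exact: homog_mxM hy (@homog_fdiff p).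
- exact: sizedM.
exists y'; first by split=> //; rewrite -vE; apply: killed_fdiff.
move=> [w [w' E]]; apply: nb.
have /killedP[w'' E'] : killed (p := p.+1) (y - koszul_mx *m w').
  by rewrite /= mulmxBl vE E mulmxDr koszul_mxK add0r mulmxA subrr.
by exists w', w''; rewrite -E' addrC subrK.
Qed.

(** Take a basis vector of degree e. Its constant term 1 in row [set0] is not attained by the two
    images: the Koszul differential is linear in the variables, and F is minimal. *)
Lemma zigzag_gen i e : betti F i e != 0%N ->
  exists2 y : 'M_(N, frank F i), zigzag 0 e y & ~ trivial_zigzag y.
Proof.
rewrite /betti -lt0n => /card_gt0P[k]; rewrite !inE => /eqP ek.
have minF j k' l : (fdiff F j k' l)@_0%MM = 0 by have [_ _ H] := F_res; apply: H.
have s0 : sized 0 (delta_mx (er set0) k : 'M[S]_(N, frank F i)).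
  move=> j l; rewrite mxE; case: (eqVneq j _) => [->|_];
      first by rewrite enum_rankK cards0.
  by rewrite eqxx.
exists (delta_mx (er set0) k).
  split=> //; last by rewrite koszul_mx_sized0 //; case: (i) => [|j] /=; rewrite mul0mx.
  move=> j l; rewrite mxE; apply/homogzP => m.
  case: (eqVneq j _) => [->|_] /=; last by rewrite mcoeff0 eqxx.
  case: (eqVneq l k) => [->|_] /=; last by rewrite mcoeff0 eqxx.
  rewrite mcoeff1; case: (eqVneq m 0%MM) => [->|]; last by rewrite eqxx.
  by rewrite mdeg0 /row_shift enum_rankK cards0 ek oppr0 addr0 subrr.
move=> [w [w' /matrixP/(_ (er set0) k)]].
move/(congr1 (mcoeff 0%MM)); rewrite mxE !eqxx mcoeff1 eqxx mxE mcoeffD koszul_mx_const0.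
rewrite mx_const0; last by right.
by rewrite addr0 => /eqP; rewrite oner_eq0.
Qed.

Variable Q : pred 'X_{1..n}.
Hypothesis QI : forall p : S, p \in I <-> forall m, p@_m != 0 -> Q m.

Lemma faug_lift (z : 'cV[S]_N) : (forall i, z i 0 \in I) <-> exists y, z = y *m faug F.
Proof.
have [_ [aug _ _] _] := F_res; split=> [zI|[y ->] i].
  have /fin_all_exists[y yP] i : exists v, (z i 0)%:M = v *m faug F by apply/aug.
  exists (\matrix_i y i); apply/row_matrixP => i.
  rewrite row_mul rowK -yP; apply/matrixP => k l.
  by rewrite !mxE (ord1 k) (ord1 l) eqxx.
apply/aug; exists (row i y); rewrite -row_mul; apply/matrixP => k l.
by rewrite !mxE (ord1 k) (ord1 l) eqxx.
Qed.

Lemma faug_lift_graded (e : int) q (z : 'cV[S]_N) : (forall i, z i 0 \in I) ->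
  homog_mx e row_shift (fun _ => 0) z -> sized q z ->
  exists y, [/\ z = y *m faug F, homog_mx e row_shift (@fshift _ _ F 0) y & sized q y].
Proof.
move=> /faug_lift[y zE] hz sz_z.
exists (homog_proj e row_shift (@fshift _ _ F 0) (rows q *m y)); split.
- by rewrite -(homog_projMr _ _ _ homog_faug) -mulmxA -zE rows_id // homog_proj_id.
- exact: homog_mx_proj.
- by move=> i k; rewrite mxE rowsE; case: ifP => [/eqP //|_]; rewrite hpart0 eqxx.
Qed.

Lemma slide p q e (y : 'M_(N, frank F p)) : zigzag q e y -> ~ trivial_zigzag y ->
  exists2 y', zigzag (p := 0) (p + q) e y' & ~ trivial_zigzag y'.
Proof.
elim: p q y => [|p IH] q y cy nb; first by exists y.
by have [y' cy' nb'] := slide_zigzag cy nb; rewrite addSnnS; apply: IH cy' nb'.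
Qed.

Lemma mcoeff_mcompB a T (z : 'cV[S]_N) : mcomp a z T != 0 ->
  (mesym1 T <= a)%MM /\ (z (er T) 0)@_(a - mesym1 T) != 0.
Proof. by rewrite ffunE; case: ifP => //; rewrite eqxx. Qed.

(** A generator is slid to F_0 and pushed into I, giving a Koszul cycle with entries in I. If it
    bounded there, lifting the filling to F_0 would trivialise the zigzag. *)
Lemma betti_Kos i e : betti F i e != 0%N ->
  exists2 a, (mdeg a)%:Z = e & ~ acyclic K i (Kos Q a).
Proof.
move=> /zigzag_gen[y0 c0 n0]; have [y [hy sy ky] nb] := slide c0 n0.
rewrite addn0 in sy.
pose z := y *m faug F.
have hz : homog_mx e row_shift (fun _ => 0) z by apply: homog_mxM hy homog_faug.
have s_z : sized i z by apply: sizedM.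
have zI : forall j, z j 0 \in I by apply/faug_lift; exists y.
have Dz : koszul_mx *m z = 0 by rewrite mulmxA; apply: ky.
apply: contrapT => H; apply: nb.
have [|w zE wQ] := @koszul_mx_lift _ _ Q z.
  move=> a; have [ae|ae] := eqVneq ((mdeg a)%:Z) e.
    have ac : acyclic K i (Kos Q a) by apply: contrapT => nac; apply: H; exists a.
    have [||b hb bE] := (acyclicP _ _ _).1 ac (mcomp a z).
    - move=> T /mcoeff_mcompB[Ta nz]; split; last first.
        have : z (er T) 0 != 0 by apply: contra nz => /eqP->; rewrite mcoeff0.
        by move/s_z; rewrite enum_rankK.
      by rewrite /Kos Ta; move: nz; apply: (QI _).1.
    - by rewrite -mcomp_koszul_mx Dz mcomp0.
    by exists b => // T /hb[].
  exists 0 => [T|]; first by rewrite ffunE eqxx.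
  rewrite bdry0; apply/ffunP => T; rewrite [LHS]ffunE; apply/eqP; rewrite eq_sym.
  apply: contraNT ae => /mcoeff_mcompB[Ta];
      move/(homogzP _ _).1: (hz (er T) 0) => /[apply].
  rewrite /row_shift enum_rankK subr0 => E; apply/eqP.
  by rewrite -[in LHS](submK Ta) mdegD PoszD E mdeg_mesym1 subrK.
have /faug_lift[w0 wE] : forall j, w j 0 \in I by move=> j; apply/QI => m; apply: wQ.
have /(killedP (p := 0))[w' E] : killed (p := 0) (y - koszul_mx *m w0).
  by rewrite /= mulmxBl -mulmxA -wE -zE subrr.
by exists w0, w'; rewrite -E addrC subrK.
Qed.

(** A cycle c, placed in the single multidegree a, is a Koszul cycle with entries in I. Its lift to
    F_0 is a zigzag, trivial if the Betti number vanishes, and the component in degree a of the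
    trivialisation fills c. *)
Lemma Kos_betti i a : ~ acyclic K i (Kos Q a) -> betti F i (mdeg a) != 0%N.
Proof.
move=> nac; apply/eqP => b0; apply: nac; apply/acyclicP => c hc c0.
pose b a' := if a' == a then c else 0.
pose z := assemble [:: a] b.
have zE a' : mcomp a' z = b a'.
  rewrite mcomp_assemble // => [|T].
    by rewrite mem_seq1 /b; case: eqP.
  by rewrite /b; case: (eqVneq a' a) => [-> /hc[/andP[]]|_] //; rewrite ffunE eqxx.
have zP T m : (z (er T) 0)@_m != 0 -> [/\ (m + mesym1 T)%MM = a, Q m & #|T| = i].
  rewrite mcoeff_mcomp zE /b; case: (eqVneq _ a) => [E|_]; last by rewrite ffunE eqxx.
  move=> /hc[/andP[_ Qm] sT]; split=> //; move: Qm; rewrite -E.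
  by congr (is_true (Q _)); apply/mnmP => k; rewrite mnmBE mnmDE addnK.
have nzP T : z (er T) 0 != 0 -> exists m, (z (er T) 0)@_m != 0.
  move=> nz; exists (mlead (z (er T) 0)).
  by rewrite mleadc_eq0.
have [|||y [yE hy sy]] := @faug_lift_graded (mdeg a) i z.
- by move=> j; rewrite -(enum_valK j); apply/QI => m /zP[].
- move=> j k; rewrite (ord1 k) -(enum_valK j); apply/homogzP => m /zP[<- _ _].
  by rewrite /row_shift enum_valK mdegD PoszD mdeg_mesym1 subr0 addrK.
- move=> j k; rewrite (ord1 k) -(enum_valK j) => /nzP[m /zP[_ _ <-]].
  by rewrite enum_valK.
have [|w [w' yw]] := @zigzag_trivial 0 i (mdeg a) b0 y.
  split=> //=; rewrite -mulmxA -yE; apply: mcomp_inj => a'.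
  by rewrite mcomp_koszul_mx zE mcomp0 /b; case: eqP => // _; rewrite bdry0.
have ww : z = koszul_mx *m (w *m faug F).
  rewrite yE yw mulmxDl mulmxA (_ : w' *m _ *m _ = 0) ?addr0 //.
  by have := killed_fdiff w'.
apply: (bdry_trim (b := mcomp a (w *m faug F)) hc).
  move=> T /mcoeff_mcompB[Ta nz]; rewrite /Kos Ta; move: nz; apply: (QI _).1.
  by apply: (faug_lift _).2; exists w.
by rewrite -mcomp_koszul_mx -ww zE /b eqxx.
Qed.
End Resolution.

(** * Heights *)

Section Height.
Variables (K : fieldType) (n : nat).
Local Notation S := {mpoly K[n]}.

Definition degle (b : nat) (p : S) := forall m, p@_m != 0 -> (mdeg m <= b)%N.

Lemma degleM b c p q : degle b p -> degle c q -> degle (b + c) (p * q).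
Proof.
move=> hp hq m; rewrite -mcoeff_msupp => /msuppM_le/allpairsP[[u v] /= [up vq ->]].
by rewrite mdegD leq_add ?hp ?hq // -mcoeff_msupp.
Qed.

Lemma degle1 : degle 0 1.
Proof. by move=> m; rewrite mcoeff1; case: (eqVneq m 0%MM) => [->|];
    rewrite ?mdeg0 // eqxx. Qed.

Lemma degleX b p e : degle b p -> degle (e * b) (p ^+ e).
Proof.
by move=> hp; elim: e => [|e IH]; [apply: degle1|rewrite exprS mulSn; apply: degleM].
Qed.

Lemma degle_prod (J : finType) (b : J -> nat) (p : J -> S) :
  (forall j, degle (b j) (p j)) -> degle (\sum_j b j)%N (\prod_j p j).
Proof.
by move=> H; elim/big_rec2: _ => [|j x y _ hy]; [apply: degle1|apply: degleM].
Qed.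

Lemma box_count k d : exists D, (((k.+1 * D * d).+1) ^ k < D ^ k.+1)%N.
Proof.
(* The left side is at most (D ((k + 1) d + 1))^k, so it suffices that D exceeds ((k + 1) d +
   1)^k. *)
pose D := ((k.+1 * d).+1 ^ k).+1; exists D.
have ltD : ((k.+1 * d).+1 ^ k < D)%N by [].
have D0 : (0 < D)%N by [].
move: D ltD D0 => D ltD D0.
apply: (@leq_ltn_trans ((D * (k.+1 * d).+1) ^ k)%N).
  have [->|k0] := posnP k; first by rewrite !expn0.
  by rewrite leq_exp2r // (mulnS D) mulnCA mulnA -[X in (X <= _)%N]add1n leq_add2r.
by rewrite expnMn expnSr ltn_pmul2l // expn_gt0 D0.
Qed.

(* n + 1 polynomials in n variables are algebraically dependent: there are more
   monomials of small degree in them than coefficients in their values. *)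
Lemma algebraic_dependence (y : n.+1.-tuple S) :
  exists2 Q : {mpoly K[n.+1]}, Q != 0 & Q \mPo y = 0.
Proof.
pose d := \max_i msize (tnth y i).
have yd i : degle d (tnth y i).
  move=> m; rewrite -mcoeff_msupp => /msize_mdeg_lt/ltnW/leq_trans; apply.
  exact: (leq_bigmax i).
have [D HD] := box_count n d.
pose B := (n.+1 * D * d).+1.
pose E := {ffun 'I_n.+1 -> 'I_D}; pose U := {ffun 'I_n -> 'I_B}.
pose ye (e : E) := \prod_i tnth y i ^+ e i.
have ye_deg (e : E) : degle (n.+1 * D * d) (ye e).
  have H : degle (\sum_(i < n.+1) e i * d) (ye e).
    by apply: degle_prod => i; apply: degleX.
  move=> m /H/leq_trans; apply; rewrite -big_distrl leq_mul2r; apply/orP; right.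
  rewrite -[X in (X * D)%N]card_ord -sum_nat_const; apply: leq_sum => i _.
  exact: ltnW.
(* Rows are the monomials in y with exponents below D, columns the possible exponents of their
   terms. There are more rows than columns, and a left kernel vector is the relation. *)
pose M := \matrix_(i < #|E|, j < #|U|)
  (ye (enum_val i))@_[multinom (enum_val j k : nat) | k < n].
have : ~~ row_free M.
  rewrite /row_free neq_ltn (leq_ltn_trans (rank_leq_col _)) //.
  by rewrite !card_ffun !card_ord.
rewrite -kermx_eq0 => /rowV0Pn[v /sub_kermxP vM v0].
pose em (e : E) : 'X_{1..n.+1} := [multinom (e i : nat) | i < n.+1].
have em_inj : injective em.
  by move=> e e' /mnmP H; apply/ffunP => i; apply/val_inj; have := H i; rewrite !mnmE.
exists (\sum_i v 0 i *: 'X_[em (enum_val i)]).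
  case/rV0Pn: v0 => i vi; apply: contra vi => /eqP/(congr1 (mcoeff (em (enum_val i)))).
  rewrite raddf_sum /= mcoeff0 (bigD1 i) //= big1 => [|j ji].
    by rewrite addr0 mcoeffZ mcoeffX eqxx mulr1 => ->.
  rewrite mcoeffZ mcoeffX; case: eqP => [/em_inj/enum_val_inj E'|_];
      last by rewrite mulr0.
  by rewrite E' eqxx in ji.
rewrite raddf_sum /=.
rewrite (eq_bigr (fun i => v 0 i *: ye (enum_val i))) => [|i _]; last first.
  by rewrite comp_mpolyZ comp_mpolyX; congr (_ *: _); apply: eq_bigr => j _; rewrite mnmE.
apply/mpolyP => m; rewrite raddf_sum mcoeff0 /=.
have [mB|mB] := boolP [forall k, (m k < B)%N]; last first.
  rewrite big1 // => i _; rewrite mcoeffZ; have [->|nz] := eqVneq (ye (enum_val i))@_m 0.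
    by rewrite mulr0.
  case/negP: mB; apply/forallP => k; rewrite ltnS; apply: leq_trans (ye_deg _ _ nz).
  by rewrite mdegE (bigD1 k) //= leq_addr.
move/forallP: mB => mB.
pose u : U := [ffun k => Ordinal (mB k)].
have /matrixP/(_ 0 (enum_rank u)) := vM; rewrite !mxE => vMu; rewrite -[RHS]vMu.
apply: eq_bigr => i _; rewrite mcoeffZ mxE; congr (_ * _@__).
by apply/mnmP => k; rewrite mnmE enum_rankK ffunE.
Qed.

(** * Elimination of variables and chains of primes *)

Section Vars.
Variable k : nat.
Implicit Types (Q R : {mpoly K[k]}).

Definition novar (b : nat) Q := forall m, Q@_m != 0 -> forall j : 'I_k, (j < b)%N ->
    m j = 0%N.

Lemma novar_sum (J : eqType) (s : seq J) (c : J -> K) (u : J -> 'X_{1..k}) b :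
  (forall i, i \in s -> forall j : 'I_k, (j < b)%N -> u i j = 0%N) ->
  novar b (\sum_(i <- s) c i *: 'X_[u i]).
Proof.
move=> H m nz j jb; apply/eqP; apply: contraT => mj; case/negP: nz.
rewrite raddf_sum big1_seq //= => i si; rewrite mcoeffZ mcoeffX.
case: eqP => [E|]; last by rewrite mulr0.
by rewrite -E (H i) ?eqxx in mj.
Qed.

Lemma split_var (b : 'I_k) Q : novar b Q ->
  exists Q0 R, [/\ Q = Q0 + 'X_b * R, novar b.+1 Q0 & novar b R].
Proof.
move=> nQ.
pose s0 := [seq m : 'X_{1..k} <- msupp Q | m b == 0%N];
    pose s1 := [seq m : 'X_{1..k} <- msupp Q | m b != 0%N].
exists (\sum_(m <- s0) Q@_m *: 'X_[m]), (\sum_(m <- s1) Q@_m *: 'X_[m - U_(b)]); split.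
- rewrite [LHS]mpolyE (bigID (fun m : 'X_{1..k} => m b == 0%N)) /= !big_filter;
    congr (_ + _).
  rewrite mulr_sumr; apply: eq_bigr => m mb; rewrite -scalerAr -mpolyXD;
      congr (_ *: 'X_[_]).
  by rewrite addmC submK // lep1mP.
- apply: novar_sum => m; rewrite mem_filter mcoeff_msupp => /andP[/eqP mb mQ] j.
  rewrite ltnS leq_eqVlt => /orP[/eqP/val_inj->|] //; exact: nQ.
- apply: novar_sum => m; rewrite mem_filter mcoeff_msupp => /andP[_ mQ] j jb.
  by rewrite mnmBE (nQ m mQ j jb).
Qed.
End Vars.

Variable F : {set 'I_n}.
Local Notation c := (n - #|F|)%N.

(** The first c + 1 variables of K[n + 1] are left free for the elements chosen along a chain in
    [chain_le]. *)
Definition face_tuple : n.-tuple {mpoly K[n.+1]} :=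
  [tuple if j \in F then 'X_(inord (c.+1 + index j (enum F))) else 0 | j < n].

(* The prime (x_j : j \notin F), with the variables of F renamed to the last
   ones of K[n + 1]. *)
Definition face_prime : {pred S} := [pred p | p \mPo face_tuple == 0].

Lemma face_primeE p : (p \in face_prime) = (p \mPo face_tuple == 0).
Proof. by []. Qed.

Lemma face_prime_prime : prime_ideal face_prime.
Proof.
split.
  split=> [||a u v]; rewrite !face_primeE ?rmorph0 ?rmorph1 ?oner_eq0 //.
  by move=> /eqP u0 /eqP v0; rewrite rmorphD rmorphM /= u0 v0 mulr0 addr0.
by move=> u v; rewrite !face_primeE rmorphM mulf_eq0.
Qed.

Lemma face_primeX (m : 'X_{1..n}) j : j \notin F -> (0 < m j)%N -> 'X_[m] \in face_prime.
Proof.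
move=> jF mj; rewrite face_primeE comp_mpolyX (bigD1 j) //= tnth_mktuple (negbTE jF).
by rewrite expr0n eqn0Ngt mj mul0r.
Qed.

(** In a longer chain choose z_i in C_{i+1} outside C_i for i <= c. With the variables of F these
    are n + 1 dependent elements; eliminating the z_i one after another leaves a nonzero relation in
    the variables of F alone, modulo [face_prime], which is impossible. *)
Lemma chain_le k : prime_chain face_prime k -> (k <= c)%N.
Proof.
move=> [C [Cp Cs CF]]; rewrite leqNgt; apply/negP => ck.
have sub i j : (i <= j <= k)%N -> {subset C i <= C j}.
  case/andP => ij; rewrite -(subnK ij) addnC; elim: (j - i)%N => [|t IH];
      first by rewrite addn0 => _ p.
  rewrite addnS => tk p pC; apply: (Cs _ tk).1; apply: IH pC; exact: ltnW.
have zE i : exists p : S, (i < k)%N -> p \in C i.+1 /\ p \notin C i.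
  have [ik|ik] := ltnP i k; last by exists 0.
  have [_ H] := Cs i ik; apply: contrapT => H'; apply: H => p pC.
  by apply: contraT => npC; case: H'; exists p.
have [z zP] := choice zE.
pose y : n.+1.-tuple S := [tuple if (i < c.+1)%N then z i else
  nth 0 [seq 'X_f | f <- enum F] (i - c.+1) | i < n.+1].
have cn : (c.+1 <= n.+1)%N by rewrite ltnS leq_subr.
(* Induction on b: some nonzero Q avoids the first b variables and takes a value in C_b. *)
have [Q [Q0 nQ QC]] : exists Q : {mpoly K[n.+1]},
    [/\ Q != 0, novar c.+1 Q & Q \mPo y \in C c.+1].
  elim: {-2}c.+1 (leqnn c.+1) => [_|b IH bc].
    have [Q nQ Qy] := algebraic_dependence y; exists Q; split=> //.
    by rewrite Qy; have [[H _ _] _] := Cp 0%N isT.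
  have {IH}[Q [Q0 nQ QC]] := IH (ltnW bc).
  have bk : (b < k)%N by apply: leq_trans ck.
  have bn : (b < n.+1)%N by apply: leq_trans cn.
  pose ib := Ordinal bn; have [zC znC] := zP b bk.
  have yb : 'X_ib \mPo y = z b by rewrite comp_mpolyXU -tnth_nth tnth_mktuple /= bc.
  have [w] := ubnP (msize Q); elim: w Q Q0 nQ QC => // w IHw Q Q0 nQ QC Qw.
  have [Q' [R [QE nQ' nR]]] := @split_var _ ib Q nQ.
  (* If Q' is nonzero, its value lies in C_{b+1} because z_b does. Otherwise Q is X_b times R, and
     z_b can be cancelled modulo the prime C_b, with R of smaller size. *)
  have [Q'0|Q'0] := eqVneq Q' 0; last first.
    exists Q'; split=> //.
    have [[_ _ idl] _] := Cp b.+1 bk.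
    rewrite (_ : Q' = Q - 'X_ib * R); last by rewrite QE addrK.
    rewrite rmorphB rmorphM /= yb addrC mulrC -mulNr.
    by apply: idl => //; apply: (Cs b bk).1.
  rewrite Q'0 add0r in QE.
  have R0 : R != 0 by apply: contra Q0 => /eqP R0; rewrite QE R0 mulr0.
  apply: (IHw R) => //.
    have [_ pr] := Cp b (ltnW bk).
    by move: QC; rewrite QE rmorphM /= yb => /pr; rewrite (negbTE znC).
  have X0 : 'X_ib != 0 :> {mpoly K[n.+1]} by rewrite -msize_poly_eq0 mmeasureX.
  by move: Qw; rewrite QE msizeM // mmeasureX /= mdeg1.
have : Q \mPo y \in face_prime by rewrite -CF; apply: sub QC; rewrite ck leqnn.
(* The substitution defining [face_prime] sends the value of Q back to Q itself. *)
rewrite face_primeE; suff -> : (Q \mPo y) \mPo face_tuple = Q by rewrite (negbTE Q0).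
rewrite [Q \mPo y]comp_mpolyEX raddf_sum [RHS]mpolyE big_seq [RHS]big_seq /=.
apply: eq_bigr => m; rewrite mcoeff_msupp => Qm.
rewrite !comp_mpolyZ; congr (_ *: _); rewrite comp_mpolyX rmorph_prod mpolyXE_id /=.
apply: eq_bigr => i _; rewrite rmorphXn /= tnth_mktuple.
case: ltnP => ic; first by rewrite (nQ _ Qm) ?expr0.
have iF : (i - c.+1 < size (enum F))%N.
  by rewrite -cardE; have := ltn_ord i; have := max_card F; rewrite card_ord; lia.
have [f0 _] : exists f : 'I_n, f \in enum F.
  by case: (enum F) iF => // f s _; exists f; rewrite mem_head.
rewrite (nth_map f0) // comp_mpolyXU -tnth_nth tnth_mktuple.
have := mem_nth f0 iF; rewrite mem_enum => ->; congr ('X_ _ ^+ _).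
by apply: val_inj; rewrite /= index_uniq ?enum_uniq // subnKC // inordK.
Qed.

(** [is_height] compares primes whose height is attained; [chain_le] bounds the chains below
    [face_prime], so a longest one exists. *)
Lemma height_le (I : {pred S}) h : {subset I <= face_prime} -> is_height I h ->
    (h <= c)%N.
Proof.
move=> IF [_ hmin].
have ex0 : exists k, `[< prime_chain face_prime k >].
  exists 0%N; apply/asboolP; exists (fun _ => face_prime); split=> // i _.
  exact: face_prime_prime.
have bound k : `[< prime_chain face_prime k >] -> (k <= c)%N by move=> /asboolP/chain_le.
case: (ex_maxnP ex0 bound) => k kP kmax.
apply: leq_trans (bound _ kP); apply: hmin; exists face_prime; split=> //.
  exact: face_prime_prime.
by split; [apply/asboolP|move=> l lP; apply: kmax; apply/asboolP].
Qed.
End Height.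

(** * Monomial ideals *)

Section FaceCoef.
Variables (K : fieldType) (n : nat) (F : {set 'I_n}).
Local Notation S := {mpoly K[n]}.

Lemma mem_face_prime_coef (p : S) (m : 'X_{1..n}) :
  p \in face_prime F -> (forall j, j \notin F -> m j = 0%N) -> p@_m = 0.
Proof.
rewrite face_primeE => /eqP p0 mF.
pose c := (n - #|F|)%N.
(* [back] undoes the renaming, so the composite keeps exactly the monomials supported in F. *)
pose back : n.+1.-tuple S := [tuple nth 0 [seq 'X_f | f <- enum F] (i - c.+1) | i < n.+1].
have backE u : ('X_[u] \mPo face_tuple K F) \mPo back =
    if [forall j, (j \notin F) ==> (u j == 0%N)] then 'X_[u] else 0.
  case: ifP => [/forallP uF|/forallPn[j]].
    rewrite comp_mpolyX rmorph_prod mpolyXE_id; apply: eq_bigr => j _.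
    rewrite rmorphXn /= tnth_mktuple; have [jF|jF] := boolP (j \in F); last first.
      by have := uF j; rewrite jF => /eqP->; rewrite !expr0.
    rewrite comp_mpolyXU -tnth_nth tnth_mktuple.
    have jE : j \in enum F by rewrite mem_enum.
    have jF' : (index j (enum F) < #|F|)%N by rewrite cardE index_mem.
    have aux x y : (y < x <= n)%N -> ((n - x).+1 + y < n.+1)%N by lia.
    have Fn := max_card F; rewrite card_ord in Fn.
    rewrite inordK; last by apply: aux; rewrite jF'.
    by rewrite addKn (nth_map j) ?index_mem // nth_index.
  rewrite negb_imply => /andP[jF uj].
  have /eqP-> : 'X_[u] \mPo face_tuple K F == 0.
    by rewrite -face_primeE; apply: face_primeX jF _; rewrite lt0n.
  exact: rmorph0.
have := congr1 (fun q => (q \mPo back)@_m) p0.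
rewrite [p \mPo _]comp_mpolyEX [X in X@_m]raddf_sum /= rmorph0 mcoeff0.
rewrite (eq_bigr (fun u => p@_u *: if [forall j, (j \notin F) ==> (u j == 0%N)]
   then 'X_[u] else 0)) => [|u _]; last by rewrite comp_mpolyZ backE.
have [mp|mp _] := boolP (m \in msupp p); last by apply/eqP; rewrite mcoeff_eq0.
rewrite raddf_sum /= (bigD1_seq m) ?msupp_uniq //= big1 => [|u um].
  rewrite addr0 mcoeffZ (_ : [forall j, _]) ?mcoeffX ?eqxx ?mulr1 //.
  by apply/forallP => j; apply/implyP => /mF->.
rewrite mcoeffZ; case: ifP; rewrite ?mcoeff0 ?mulr0 // mcoeffX.
by rewrite (negbTE um) mulr0.
Qed.
End FaceCoef.

Section MonomialIdeal.
Variables (K : fieldType) (n : nat).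
Local Notation S := {mpoly K[n]}.
Variable I : {pred S}.
Hypothesis I_ideal : idealr_closed I.
Implicit Types (u v m : 'X_{1..n}).

Lemma idealM p q : q \in I -> p * q \in I.
Proof. by case: I_ideal => I0 _ H qI; rewrite -[_ * _]addr0; apply: H. Qed.

Lemma ideal_sum (J : eqType) (s : seq J) (f : J -> S) :
  (forall i, i \in s -> f i \in I) -> \sum_(i <- s) f i \in I.
Proof.
case: I_ideal => I0 _ H; elim: s => [|i s IH] fI; first by rewrite big_nil.
rewrite big_cons -[f i]mul1r; apply: H; first by apply: fI; rewrite mem_head.
by apply: IH => j js; apply: fI; rewrite inE js orbT.
Qed.

Definition mono_mem : pred 'X_{1..n} := fun u => 'X_[u] \in I.

Lemma upward_mono_mem : upward mono_mem.
Proof. by move=> u v uv uI; rewrite /mono_mem -(submK uv) mpolyXD; apply: idealM. Qed.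

Lemma generate_le A p m : monomials_generate A I -> p \in I -> p@_m != 0 ->
  exists2 u, A u & (u <= m)%MM.
Proof.
move=> AI /AI[s [sA ->]] nz.
apply: contrapT => H; case/negP: nz; rewrite raddf_sum big1_seq //= => x xs.
by rewrite mulrC mcoeffXM; case: ifP => // um; case: H; exists x.2 => //; apply: sA.
Qed.

Lemma generate_mono_mem A u : monomials_generate A I -> A u -> mono_mem u.
Proof.
move=> AI Au; apply/AI; exists [:: (1, u)]; split=> [x|].
  by rewrite mem_seq1 => /eqP->.
by rewrite big_seq1 mul1r.
Qed.

Lemma mono_memP : monomial_ideal I -> forall p, p \in I <-> forall m, p@_m != 0 ->
    mono_mem m.
Proof.
move=> [A AI] p; split=> [pI m nz|H].
  have [u Au um] := generate_le AI pI nz.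
  exact: upward_mono_mem um (generate_mono_mem AI Au).
rewrite [p]mpolyE; apply: ideal_sum => m; rewrite mcoeff_msupp => /H mI.
by rewrite -mul_mpolyC; apply: idealM.
Qed.

Lemma is_gamma_pos g : is_gamma I g -> (0 < g)%N.
Proof. by move=> [G _ [[u [j [_ uj ->]]] _]]. Qed.

(** A generator dividing a monomial with exponent below g at j cannot involve x_j, so x_j may be
    divided out and [acyclic_flat] applies. *)
Lemma is_gamma_acyclic g (a : 'X_{1..n}) i j : is_gamma I g -> (0 < a j < g)%N ->
    acyclic K i (Kos mono_mem a).
Proof.
move=> [G [GI _] [_ gmin]] /andP[a0 ag].
apply: (@acyclic_flat _ _ _ j) => // [|u uj uI]; first exact: upward_mono_mem.
have [|v Gv /mnm_lepP vu] := generate_le (m := u) GI uI.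
  by rewrite mcoeffX eqxx oner_eq0.
apply: upward_mono_mem (generate_mono_mem GI Gv); apply/mnm_lepP => k.
rewrite mnmBE mnm1E; case: (eqVneq j k) => [<-|_]; last by rewrite subn0.
have [->//|vj] := posnP (v j).
have : (g <= v j)%N by apply: gmin; exists v, j.
by have := vu j; rewrite uj; lia.
Qed.

Local Notation rad := (partial_radical setT mono_mem).

Lemma mono_mem_radical u : rad u <-> 'X_[u] \in radical I.
Proof.
have E k : mono_mem (scale_exp setT k u) = ('X_[u] ^+ k \in I).
  rewrite mpolyXn; congr ('X_[_] \in I); apply/mnmP => j.
  by rewrite scale_expE inE mulmnE mulnC.
by split=> /asboolP[k kI]; apply/asboolP; exists k; rewrite ?E // -E.
Qed.

Lemma rad_supp u (v : 'X_{1..n}) : (forall j, (0 < u j)%N -> (0 < v j)%N) -> rad u ->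
    rad v.
Proof.
(* Exponents of v on the support of u are at least 1, so multiplying them by mdeg u bounds those of
   u. *)
move=> uv /asboolP[N NI]; apply/asboolP; exists (N * mdeg u)%N.
apply: upward_mono_mem NI; apply/mnm_lepP => j; rewrite !scale_expE inE.
have [->|uj] := posnP (u j); first by rewrite muln0.
rewrite -mulnA leq_mul2l; apply/orP; right; apply: (@leq_trans (mdeg u)).
  by rewrite mdegE (bigD1 j) //= leq_addr.
by rewrite leq_pmulr // uv.
Qed.

Lemma sqfree_rad : sqfree rad.
Proof. by move=> u v uv; apply: rad_supp => j; rewrite !lt0n uv. Qed.

Lemma rad0 : ~~ rad 0%MM.
Proof.
apply/negP => /asboolP[N]; rewrite (_ : scale_exp _ _ _ = 0%MM); last first.
  by apply/mnmP => j; rewrite scale_expE inE mnm0E muln0.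
by rewrite /mono_mem mpolyX0; case: I_ideal => _ /negP.
Qed.

Hypothesis I_monomial : monomial_ideal I.

(** A monomial of I supported in F would put the product of the variables of F in the radical; so
    every monomial of I involves a variable outside F. *)
Lemma sub_face_prime (F : {set 'I_n}) : ~~ rad (mesym1 F) -> {subset I <= face_prime F}.
Proof.
move=> nF p pI; have [[_ _ id] _] := face_prime_prime K F.
have fsum (s : seq 'X_{1..n}) : (forall m, m \in s -> m \in msupp p) ->
    \sum_(m <- s) p@_m *: 'X_[m] \in face_prime F.
  elim: s => [|m s IH] sp; first by rewrite big_nil face_primeE rmorph0.
  rewrite big_cons -mul_mpolyC; apply: id; last first.
    by apply: IH => u us; apply: sp; rewrite inE us orbT.
  have mI : mono_mem m by apply: (mono_memP I_monomial p).1;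
      rewrite // -mcoeff_msupp sp // mem_head.
  have [j /andP[jF mj]] : exists j, (j \notin F) && (0 < m j)%N.
    apply: contrapT => H; case/negP: nF; apply: rad_supp (_ : rad m) => [j mj|].
      rewrite mesym1_mem lt0b; apply: contraT => jF; by case: H; exists j; rewrite jF.
    apply/asboolP; exists 1%N; apply: upward_mono_mem mI; apply/mnm_lepP => j.
    by rewrite scale_expE inE mul1n.
  exact: face_primeX jF mj.
by rewrite [p]mpolyE; apply: fsum.
Qed.

Lemma radicalD p q : p \in radical I -> q \in radical I -> p + q \in radical I.
Proof.
move=> /asboolP[k pI] /asboolP[l qI]; apply/asboolP; exists (k + l)%N.
rewrite exprDn; apply: ideal_sum => i _; rewrite -mulr_natl; apply: idealM.
have [li|il] := leqP l i; first by rewrite -(subnK li) exprD mulrA; apply: idealM.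
rewrite mulrC (_ : (k + l - i)%N = (l - i) + k)%N; last by lia.
by rewrite exprD mulrA; apply: idealM.
Qed.

(** If a term m of p were outside [rad], the face prime of its support would contain I, hence p, and
    so kill the coefficient at m. Conversely the radical is closed under sums. *)
Lemma radicalP p : p \in radical I <-> forall m, p@_m != 0 -> rad m.
Proof.
split=> [/asboolP[k pI] m nz|H].
  apply: contraT => nm; pose F := [set j | (0 < m j)%N].
  have nF : ~~ rad (mesym1 F).
    apply: contra nm; apply: rad_supp => j; rewrite mesym1_mem inE lt0b; exact.
  have [[_ F1 _] Fpr] := face_prime_prime K F.
  have pF : p \in face_prime F.
    have := sub_face_prime nF pI; elim: k {pI} => [|k IH].
      by rewrite expr0 (negbTE F1).
    by rewrite exprS => /Fpr/orP[//|/IH].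
  case/negP: nz; apply/eqP; apply: mem_face_prime_coef pF _ => j.
  by rewrite inE -eqn0Ngt => /eqP.
rewrite [p]mpolyE; have : {in msupp p, forall m, rad m} by move=> m;
    rewrite mcoeff_msupp => /H.
elim: (msupp p) => [|m s IH] sP.
  by rewrite big_nil; apply/asboolP; exists 1%N; rewrite expr1; case: I_ideal.
rewrite big_cons; apply: radicalD; last first.
  by apply: IH => u us; apply: sP; rewrite inE us orbT.
have /mono_mem_radical/asboolP[k kI] : rad m by apply: sP; rewrite mem_head.
by apply/asboolP; exists k; rewrite -mul_mpolyC exprMn; apply: idealM.
Qed.
End MonomialIdeal.

(** * The regularity bound *)

Lemma acyclic_small (R : comNzRingType) n (P : pred 'X_{1..n}) a i : (mdeg a < i)%N ->
    acyclic R i (Kos P a).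
Proof.
move=> ai c hc _; exists 0, 0; split; try exact: csupp0.
rewrite bdry0 add0r; apply/ffunP => T; rewrite [RHS]ffunE; apply/eqP; apply: contraT.
move=> /hc[/andP[Ta _] sT]; move: ai.
by rewrite -(submK Ta) mdegD mdeg_mesym1 sT ltnNge leq_addl.
Qed.

Theorem theorem2p2 (K : fieldType) (n : nat) (I : {pred {mpoly K[n]}})
    (I_proper_ideal : idealr_closed I)
    (I_nonzero : exists2 p, p \in I & p != 0)
    (I_monomial : monomial_ideal I)
    (g h : nat) (r r' : int)
    (g_gamma : is_gamma I g)
    (h_height : is_height I h)
    (r_reg : is_regularity I r)
    (r'_reg : is_regularity (radical I) r') :
  r' + (g%:Z - 1) * h%:Z <= r.
Proof.
have [F' res' [[i0 [j0 [b0 r'E]]] max']] := r'_reg.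
have [F res [_ max]] := r_reg.
have Pu := upward_mono_mem I_proper_ideal.
pose Q := partial_radical setT (mono_mem I).
have Qu : upward Q by apply: upward_partial_radical.
have Qs : sqfree Q by apply: sqfree_rad.
have [a0 a0j nac0] := betti_Kos res' (radicalP I_proper_ideal I_monomial) b0.
(* Faces of size i0 need degree at least i0, so the subtraction defining s does not truncate. *)
have i0a0 : (i0 <= mdeg a0)%N.
  by rewrite leqNgt; apply/negP => /(acyclic_small (R := K) (P := Q)).
pose s := (mdeg a0 - i0)%N.
have sE : r' = s%:Z by rewrite r'E -a0j subzn.
have bound b i : ~ acyclic K i (Kos Q b) -> (mdeg b <= i + s)%N.
  move=> /(Kos_betti res' (radicalP I_proper_ideal I_monomial)) nb.
  have /max' : exists i1 j1, betti F' i1 j1 != 0%N /\ (mdeg b)%:Z - i%:Z = j1 - i1%:Z.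
    by exists i, (mdeg b)%:Z.
  by rewrite sE; lia.
have [|a [i [ai ext nac]]] := extremal_exists Qu Qs bound _ nac0; first by rewrite subnKC.
have a1 j : (a j <= 1)%N.
  by rewrite leqNgt; apply/negP => aj; apply: nac; apply: acyclic_sqfree aj.
have nF := extremal_nonface Qu Qs (rad0 I_proper_ideal) ai ext nac.
have ha : (h <= mdeg a)%N.
  apply: leq_trans (height_le (sub_face_prime I_proper_ideal I_monomial nF) h_height) _.
  set A := [set j | _]; have -> : (n - #|A|)%N = #|~: A|.
    by have := cardsC A; rewrite card_ord; lia.
  rewrite mdegE -sum1_card big_mkcond; apply: leq_sum => j _.
  by rewrite !inE -lt0n; case: ifP.
have [a' supp_a' nac'] := radical_descent Pu a1 nac.
(* On the support of a, an exponent of a' below g would make the complex acyclic. *)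
have ga : (g * mdeg a <= mdeg a')%N.
  rewrite !mdegE big_distrr /=; apply: leq_sum => j _.
  have [->|aj] := posnP (a j); first by rewrite muln0.
  have -> : a j = 1%N by have := a1 j; lia.
  rewrite muln1 leqNgt; apply/negP => a'g; apply: nac'.
  apply: (is_gamma_acyclic I_proper_ideal (j := j) g_gamma);
      rewrite a'g andbT lt0n supp_a'.
  by rewrite -lt0n.
have /max : exists i1 j1, betti F i1 j1 != 0%N /\ (mdeg a')%:Z - i%:Z = j1 - i1%:Z.
  exists i, (mdeg a')%:Z; split=> //.
  exact: (Kos_betti res (mono_memP I_proper_ideal I_monomial)).
(* Now r >= mdeg a' - i >= g mdeg a - i = s + (g - 1) mdeg a, and g >= 1 allows mdeg a to be
   replaced by h. *)
have := is_gamma_pos g_gamma.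
rewrite sE; nia.
Qed.
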